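(* The decision problem OCLIQUEISO — given a pair of oriented cliques $G$ and $H$, decide whether $G\cong H$ — is GI-complete.
   Context: An oriented graph is a finite simple loopless graph in which each edge is assigned a direction. An oriented clique is an oriented graph in which any two non-adjacent vertices are the two ends of a directed path of length $2$. A problem is GI-complete if it is polynomial-time equivalent to (i.e., polynomial-time reducible to and from) the graph isomorphism problem. *)

(* Defs.v *)
From mathcomp Require Import all_boot all_order all_algebra.

Set Implicit Arguments.
Unset Strict Implicit.
Unset Printing Implicit Defensive.

(** The blank is [None], and [X] holds the work symbols other than 0 and 1. *)
Definition symbol (X : finType) : finType := option (bool + X).

Definition blank {X : finType} : symbol X := None.
Definition bit {X : finType} (b : bool) : symbol X := Some (inl b).

Inductive direction := Left | Stay | Right.

(** A two-way infinite tape [(l, r)]: [r] lists the cells from the scanned one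
    rightwards, [l] the cells strictly left of the scanned one, nearest first;
    all cells that are not listed are blank. *)
Definition tape (X : finType) : Type := (seq (symbol X) * seq (symbol X))%type.

Definition read {X : finType} (t : tape X) : symbol X := head blank t.2.

Definition write {X : finType} (s : symbol X) (t : tape X) : tape X :=
  (t.1, s :: behead t.2).

Definition move {X : finType} (d : direction) (t : tape X) : tape X :=
  match d with
  | Left => (behead t.1, head blank t.1 :: t.2)
  | Stay => t
  | Right => (head blank t.2 :: t.1, behead t.2)
  end.

(** Deterministic multi-tape Turing machines, with [tapes_pred.+1] tapes. *)
Record machine := Machine {
  tapes_pred : nat;
  work : finType;
  state : finType;
  start : state;
  halting : pred state;
  trans : state -> {ffun 'I_tapes_pred.+1 -> symbol work} ->
          state * ('I_tapes_pred.+1 -> symbol work * direction)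
}.

Definition config (M : machine) : Type :=
  (state M * ('I_(tapes_pred M).+1 -> tape (work M)))%type.

Definition step (M : machine) (c : config M) : config M :=
  if halting c.1 then c else
  let a := trans c.1 [ffun i => read (c.2 i)] in
  (a.1, fun i => move (a.2 i).2 (write (a.2 i).1 (c.2 i))).

(** The input is on the first tape, with the head on its first letter. *)
Definition init (M : machine) (x : seq bool) : config M :=
  (start M,
   fun i => if i == ord0 then ([::], [seq bit b | b <- x]) else ([::], [::])).

Fixpoint bits_prefix {X : finType} (s : seq (symbol X)) : seq bool :=
  if s is Some (inl b) :: s' then b :: bits_prefix s' else [::].

(** The output is on the last tape, from the head up to the first cell that
    does not hold a bit. *)
Definition output (M : machine) (c : config M) : seq bool :=
  bits_prefix (c.2 ord_max).2.

(** Halting configurations are fixed by [step], so this bounds the running time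
    by [t]. *)
Definition computes_within (M : machine) (x y : seq bool) (t : nat) : Prop :=
  let c := iter t (@step M) (init M x) in halting c.1 /\ output c = y.

Definition polytime (f : seq bool -> seq bool) : Prop :=
  exists (M : machine) (p : {poly nat}),
    forall x : seq bool, computes_within M x (f x) (p.[size x])%R.

(** A decision problem is the set of encodings of its yes-instances; words that
    do not encode an instance are thus treated as no-instances. *)
Definition problem : Type := seq bool -> Prop.

(** Many-one (Karp) reducibility. *)
Definition poly_reducible (A B : problem) : Prop :=
  exists2 f : seq bool -> seq bool,
    polytime f & forall x : seq bool, A x <-> B (f x).

Definition poly_equivalent (A B : problem) : Prop :=
  poly_reducible A B /\ poly_reducible B A.

Definition simple_graph (T : finType) (e : rel T) : Prop :=
  symmetric e /\ irreflexive e.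

(** [e u v] means that there is an arc from [u] to [v]. *)
Definition oriented_graph (T : finType) (e : rel T) : Prop :=
  irreflexive e /\ (forall u v : T, ~~ (e u v && e v u)).

Definition directed_2path (T : finType) (e : rel T) (u v : T) : Prop :=
  exists w : T, e u w && e w v.

Definition oriented_clique (T : finType) (e : rel T) : Prop :=
  oriented_graph e /\
  forall u v : T, u != v -> ~~ (e u v || e v u) ->
    directed_2path e u v \/ directed_2path e v u.

Definition isomorphic (T1 T2 : finType) (e1 : rel T1) (e2 : rel T2) : Prop :=
  exists2 f : T1 -> T2, bijective f & forall u v : T1, e2 (f u) (f v) = e1 u v.

(** The number of vertices in unary, followed by the adjacency matrix row by
    row. This is self-delimiting, so pairs are encoded by concatenation. *)
Definition encode (n : nat) (e : rel 'I_n) : seq bool :=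
  nseq n true ++ false :: [seq e i j | i <- enum 'I_n, j <- enum 'I_n].

Definition iso_problem (P : forall T : finType, rel T -> Prop) : problem :=
  fun x => exists (n m : nat) (G : rel 'I_n) (H : rel 'I_m),
    [/\ P _ G, P _ H, x = encode G ++ encode H & isomorphic G H].

Definition GI : problem := iso_problem simple_graph.
Definition OCLIQUEISO : problem := iso_problem oriented_clique.

Definition GI_complete (A : problem) : Prop := poly_equivalent A GI.

(* Main.v *)
(** To reduce graph isomorphism to isomorphism of oriented cliques, replace a
    simple graph by three copies of its vertex set whose underlying graph is
    complete tripartite, orienting the arcs between the first two copies by
    adjacency and the other arcs by equality of vertices; two vertices adjacent to
    all others fix the roles of the copies. Conversely, an oriented graph becomes
    a simple graph by splitting each vertex into an out-port and an in-port with a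
    common neighbour, marked by different numbers of pendant vertices. In both
    directions an entry of the new adjacency matrix is a quantifier-free formula
    in the old one, and validity of the input is a first-order formula. Such
    formulas, with nested loops over the positions of the input and the index
    arithmetic needed to address a matrix, are evaluated in polynomial time by a
    Turing machine that keeps every variable in unary on a tape of its own. *)
Require Import Defs.
From mathcomp Require Import all_boot all_order all_algebra.
From mathcomp Require Import zify.

Set Implicit Arguments.
Unset Strict Implicit.
Unset Printing Implicit Defensive.

(** * Turing machine fragments *)

(** A Karp reduction has to treat every word, so a word that encodes no valid pair must become a
    no-instance: it is sent to the empty word, which encodes no pair. The sizes [n] and [m] are
    never computed. The program tries all pairs of input positions and outputs something only for a
    pair that parses the input as two valid graphs; since encodings are self-delimiting at most one
    pair parses, and the concatenation of all outputs is that of the right pair.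

    Unary registers are affordable because a program is fixed, its loops run over input positions,
    and its values stay polynomially bounded.

    On the graph side the delicate point is that isomorphism is reflected. Once invariants have told
    the layers apart, an isomorphism of the images gives one vertex map per layer, and nothing so
    far makes these maps equal. The adjacency is stored between two layers; the third one links the
    copies of each vertex and forces the maps to coincide. *)

Section Fragments.

Variable k : nat.
Local Notation I := 'I_k.+1.
Local Notation sym := (symbol void).
Local Notation tapes := (I -> tape void).

(** The two exits [inr true] and [inr false] let one notion serve for both commands and tests. *)
Record fragment := Fragment {
  node : finType;
  entry : node;
  delta : node -> {ffun I -> sym} -> (node + bool) * (I -> sym * direction)
}.

Definition scan (T : tapes) : {ffun I -> sym} := [ffun i => read (T i)].

Definition apply (a : I -> sym * direction) (T : tapes) : tapes :=
  fun i => move (a i).2 (write (a i).1 (T i)).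

Inductive exec (F : fragment) : node F -> tapes -> nat -> bool -> tapes -> Prop :=
| exec_exit q T b a :
    delta q (scan T) = (inr b, a) -> exec q T 1 b (apply a T)
| exec_step q T q' a t b T' :
    delta q (scan T) = (inl q', a) -> exec q' (apply a T) t b T' ->
    exec q T t.+1 b T'.

(** A step rewrites the scanned cell of every tape and thereby lists it even if
    it is blank, so tapes are only determined up to unlisted blanks. *)
Definition same_tape (t t' : tape void) :=
  (forall n, nth blank t.1 n = nth blank t'.1 n) /\
  (forall n, nth blank t.2 n = nth blank t'.2 n).

Definition same_tapes (A B : tapes) := forall i, same_tape (A i) (B i).

Lemma same_tape_refl t : same_tape t t. Proof. by []. Qed.

Lemma same_tape_sym t t' : same_tape t t' -> same_tape t' t.
Proof. by case=> h1 h2; split. Qed.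

Lemma same_tape_trans t2 t1 t3 :
  same_tape t1 t2 -> same_tape t2 t3 -> same_tape t1 t3.
Proof. by case=> h1 h2 [h3 h4]; split=> n; rewrite (h1, h2) (h3, h4). Qed.

Lemma same_tape_read t t' : same_tape t t' -> read t = read t'.
Proof. by case=> _ /(_ 0); rewrite !nth0. Qed.

Lemma same_tape_move d s t t' :
  same_tape t t' -> same_tape (move d (write s t)) (move d (write s t')).
Proof.
move=> [h1 h2]; case: t t' h1 h2 => [l r] [l' r'] /= h1 h2.
have h1' n : nth blank (behead l) n = nth blank (behead l') n.
  by rewrite !nth_behead.
have h2' n : nth blank (behead r) n = nth blank (behead r') n.
  by rewrite !nth_behead.
have h0 : head blank l = head blank l' by rewrite -!nth0.
by case: d; split=> n /=; case: n => [|[|n]] //=.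
Qed.

Lemma same_tape_stay t : same_tape (move Stay (write (read t) t)) t.
Proof.
by case: t => l r; split=> -[|n] //=; rewrite /read ?nth_behead //= nth0.
Qed.

Lemma same_scan A B : same_tapes A B -> scan A = scan B.
Proof. by move=> h; apply/ffunP=> i; rewrite !ffunE; apply: same_tape_read. Qed.

Lemma same_apply a A B : same_tapes A B -> same_tapes (apply a A) (apply a B).
Proof. by move=> h i; apply: same_tape_move. Qed.

(** The time is an upper bound, and both ends are taken up to unlisted blanks; this makes
    specifications composable without tracking exact step counts or exact lists. *)
Definition runs (F : fragment) (A : tapes) (t : nat) (b : bool) (B : tapes) :=
  forall T, same_tapes T A ->
  exists t' T', [/\ t' <= t, same_tapes T' B & exec (entry F) T t' b T'].

Lemma runs_weaken F A A' t t' b B B' :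
  runs F A t b B -> same_tapes A' A -> same_tapes B B' -> t <= t' ->
  runs F A' t' b B'.
Proof.
move=> h hA hB ht T hT.
have [i|t1 [T1 [h1 h2 h3]]] := h T; first exact: same_tape_trans (hT i) (hA i).
exists t1, T1; split=> //; first exact: leq_trans h1 ht.
by move=> i; apply: same_tape_trans (h2 i) (hB i).
Qed.

Definition act (g : {ffun I -> sym} -> bool * (I -> sym * direction)) :=
  @Fragment unit tt (fun _ a => (inr (g a).1, (g a).2)).

Lemma runs_act g A B :
  same_tapes (apply (g (scan A)).2 A) B -> runs (act g) A 1 (g (scan A)).1 B.
Proof.
move=> h T hT; exists 1, (apply (g (scan T)).2 T); split=> //.
  rewrite (same_scan hT) => i; apply: same_tape_trans (h i).
  exact: same_apply.
by rewrite -(same_scan hT); apply: exec_exit.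
Qed.

(** The exit transition of [F] is redirected to the entry of the next fragment, so that composition
    inserts no extra step and running times simply add up. *)
Definition branch (F F1 F2 : fragment) : fragment :=
  let next (b : bool) : node F + (node F1 + node F2) :=
    if b then inr (inl (entry F1)) else inr (inr (entry F2)) in
  @Fragment (node F + (node F1 + node F2))%type (inl (entry F))
    (fun q a => match q with
     | inl q => let r := delta q a in
         (inl (match r.1 with inl q' => inl q' | inr b => next b end), r.2)
     | inr (inl q) => let r := delta q a in
         (match r.1 with inl q' => inl (inr (inl q')) | inr b => inr b end, r.2)
     | inr (inr q) => let r := delta q a in
         (match r.1 with inl q' => inl (inr (inr q')) | inr b => inr b end, r.2)
     end).

Lemma exec_branch1 F F1 F2 q T t b T' :
  exec q T t b T' -> @exec (branch F F1 F2) (inr (inl q)) T t b T'.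
Proof.
elim=> {q T t b T'} [q T b a h|q T q' a t b T' h _ ih].
  by apply: exec_exit; rewrite /= h.
by apply: (@exec_step (branch F F1 F2) _ _ (inr (inl q')) a) => //; rewrite /= h.
Qed.

Lemma exec_branch2 F F1 F2 q T t b T' :
  exec q T t b T' -> @exec (branch F F1 F2) (inr (inr q)) T t b T'.
Proof.
elim=> {q T t b T'} [q T b a h|q T q' a t b T' h _ ih].
  by apply: exec_exit; rewrite /= h.
by apply: (@exec_step (branch F F1 F2) _ _ (inr (inr q')) a) => //; rewrite /= h.
Qed.

Lemma exec_branch F F1 F2 q T t b T1 t' b' T2 :
  exec q T t b T1 ->
  exec (entry (if b then F1 else F2)) T1 t' b' T2 ->
  @exec (branch F F1 F2) (inl q) T (t + t') b' T2.
Proof.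
elim=> {q T t b T1} [q T b a h|q T q' a t b T' h _ ih] h'; last first.
  rewrite addSn.
  by apply: (@exec_step (branch F F1 F2) _ _ (inl q') a); rewrite /= ?h //; apply: ih.
rewrite add1n; case: b h h' => h h'.
  apply: (@exec_step (branch F F1 F2) _ _ (inr (inl (entry F1))) a); rewrite /= ?h //.
  exact: exec_branch1.
apply: (@exec_step (branch F F1 F2) _ _ (inr (inr (entry F2))) a); rewrite /= ?h //.
exact: exec_branch2.
Qed.

Lemma runs_branch F F1 F2 A t b B t' b' C :
  runs F A t b B -> runs (if b then F1 else F2) B t' b' C ->
  runs (branch F F1 F2) A (t + t') b' C.
Proof.
move=> h h' T /h[t1 [T1 [ht1 hT1 e1]]].
have [t2 [T2 [ht2 hT2 e2]]] := h' _ hT1.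
exists (t1 + t2), T2; split=> //; first exact: leq_add.
exact: exec_branch e1 e2.
Qed.

Definition chain (F G : fragment) := branch F G G.

Lemma runs_chain F G A t b B t' b' C :
  runs F A t b B -> runs G B t' b' C -> runs (chain F G) A (t + t') b' C.
Proof. by move=> h h'; apply: runs_branch h _; case: b. Qed.

Definition loop (F : fragment) : fragment :=
  @Fragment (node F) (entry F)
    (fun q a => let r := delta q a in
       (match r.1 with
        | inl q' => inl q'
        | inr b => if b then inl (entry F) else inr true
        end, r.2)).

Lemma exec_loop F (q : node F) T t b T1 : exec q T t b T1 ->
  if b then
    forall t' b' T2, @exec (loop F) (entry F) T1 t' b' T2 ->
    @exec (loop F) q T (t + t') b' T2
  else @exec (loop F) q T t true T1.
Proof.
elim=> {q T t b T1} [q T [] a h|q T q' a t [] T' h _ ih].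
- move=> t' b' T2 h'; rewrite add1n.
  by apply: (@exec_step (loop F) _ _ (entry F) a) => //; rewrite /= h.
- by apply: exec_exit; rewrite /= h.
- move=> t' b' T2 h'; rewrite addSn.
  by apply: (@exec_step (loop F) _ _ q' a); [rewrite /= h | apply: ih].
by apply: (@exec_step (loop F) _ _ q' a) => //; rewrite /= h.
Qed.

(** The family [f] acts as loop invariant: [f j] describes the tapes after [j] rounds. The closing
    round, which exits with [false], is charged as well and may still change the tapes. *)
Lemma runs_loop F (f : nat -> tapes) n t B :
  (forall j, j < n -> runs F (f j) t true (f j.+1)) ->
  runs F (f n) t false B -> runs (loop F) (f 0) (n.+1 * t) true B.
Proof.
elim: n f => [|n ih] f h h'.
  move=> T /h'[t1 [T1 [ht hT1 /exec_loop e]]].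
  by exists t1, T1; rewrite mul1n.
move=> T hT; have [t1 [T1 [ht hT1 /exec_loop e]]] := h 0 isT T hT.
have [//|//|t2 [T2 [ht2 hT2 e2]]] := ih (fun j => f j.+1) _ _ _ hT1.
  by move=> j; apply: (h j.+1).
exists (t1 + t2), T2; split; rewrite ?mulSn ?leq_add //.
exact: e e2.
Qed.

Definition sweep (P : {ffun I -> sym} -> bool)
    (w : I -> sym -> sym * direction) :=
  act (fun a => if P a then (true, fun i => w i (a i))
                else (false, fun i => (a i, Stay))).

Lemma runs_sweep (P : pred {ffun I -> sym}) w A B : P (scan A) ->
  (forall i, same_tape (move (w i (read (A i))).2
                         (write (w i (read (A i))).1 (A i))) (B i)) ->
  runs (sweep P w) A 1 true B.
Proof.
rewrite /sweep => hP h.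
set g := (fun a => _); have -> : true = (g (scan A)).1 by rewrite /g hP.
by apply: runs_act => i; rewrite /g hP /= /apply /scan ffunE.
Qed.

Lemma runs_sweep_false (P : pred {ffun I -> sym}) w A :
  ~~ P (scan A) -> runs (sweep P w) A 1 false A.
Proof.
rewrite /sweep => hP.
set g := (fun a => _).
have -> : false = (g (scan A)).1 by rewrite /g (negPf hP).
apply: runs_act => i; rewrite /g (negPf hP) /apply [X in X.2]/= [X in X.1]/= /scan.
by rewrite ffunE; apply: same_tape_stay.
Qed.

Lemma runs_loop_sweep (P : pred {ffun I -> sym}) w (f : nat -> tapes) n :
  (forall j, j < n -> P (scan (f j))) ->
  (forall j i, j < n -> same_tape (move (w i (read (f j i))).2
                         (write (w i (read (f j i))).1 (f j i))) (f j.+1 i)) ->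
  ~~ P (scan (f n)) ->
  runs (loop (sweep P w)) (f 0) n.+1 true (f n).
Proof.
move=> h1 h2 h3; rewrite -[n.+1]muln1; apply: (@runs_loop _ f n).
  by move=> j hj; apply: runs_sweep => [|i]; [exact: h1 | exact: h2].
exact: runs_sweep_false.
Qed.

Definition keep (s : sym) := (s, Stay).
Definition shift (d : direction) (s : sym) := (s, d).
Definition put (d : direction) (s' s : sym) : sym * direction := (s', d).

Definition on (i : I) (g : sym -> sym * direction) (w : I -> sym -> sym * direction) :=
  fun j => if j == i then g else w j.
Definition idle : I -> sym -> sym * direction := fun _ => keep.

Definition upd (A : tapes) i t : tapes := fun j => if j == i then t else A j.

Definition ret (b : bool) := act (fun a => (b, fun i => (a i, Stay))).

Lemma runs_ret b A : runs (ret b) A 1 b A.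
Proof.
apply: (@runs_act (fun a => (b, fun i => (a i, Stay)))) => i.
by rewrite /apply /= /scan ffunE; apply: same_tape_stay.
Qed.

(** * Words on a tape and head movements along them *)

Definition word_tape (w : seq sym) j : tape void := (rev (take j w), drop j w).

(** With no blank inside the word, the first blank on either side of the head marks an end of it. *)
Definition filled (w : seq sym) := all (predC1 (blank : sym)) w.

Lemma read_word_tape w j : read (word_tape w j) = nth blank w j.
Proof. by rewrite /read /= -nth0 nth_drop addn0. Qed.

Lemma nonblank_nth w j : filled w -> (nth blank w j != blank) = (j < size w).
Proof.
move=> /allP h; case: ltnP => hj; last by rewrite nth_default.
by apply: h; rewrite mem_nth.
Qed.

Lemma move_right w j : j < size w ->
  move Right (write (read (word_tape w j)) (word_tape w j)) = word_tape w j.+1.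
Proof.
move=> hj; rewrite read_word_tape /move /write /word_tape /=.
by rewrite (take_nth blank) // rev_rcons (drop_nth blank hj).
Qed.

Lemma move_left w j : j < size w ->
  same_tape (move Left (write (read (word_tape w j.+1)) (word_tape w j.+1)))
    (word_tape w j).
Proof.
move=> hj; rewrite read_word_tape /move /write /word_tape /=.
rewrite (take_nth blank) // rev_rcons /=; split=> //= n.
rewrite [drop j w](drop_nth blank hj).
by case: n => [|[|n]] //=; rewrite ?nth_behead !nth_drop ?addn0 // addSnnS.
Qed.

Lemma move_left0 w :
  same_tape (move Left (write (read (word_tape w 0)) (word_tape w 0)))
    ([::], blank :: w).
Proof. by case: w => [|s w]; split=> -[|[|[|n]]]. Qed.

Definition nonblank i (a : {ffun I -> sym}) := a i != blank.

(** The first move is unconditional because the head may stand on the blank behind the word, where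
    the loop would stop at once. The loop overshoots to the blank before the word, and the last move
    corrects this. *)
Definition rewind i :=
  chain (sweep xpredT (on i (shift Left) idle))
  (chain (loop (sweep (nonblank i) (on i (shift Left) idle)))
         (sweep xpredT (on i (shift Right) idle))).

Lemma sweep_upd i g w A t t' :
  same_tape (move (g (read t)).2 (write (g (read t)).1 t)) t' ->
  (forall j, j != i -> same_tape (move (w j (read (A j))).2
                         (write (w j (read (A j))).1 (A j))) (A j)) ->
  forall j, same_tape (move (on i g w j (read (upd A i t j))).2
     (write (on i g w j (read (upd A i t j))).1 (upd A i t j))) (upd A i t' j).
Proof.
move=> h1 h2 j; rewrite /on /upd; case: eqP => [//|/eqP]; exact: h2.
Qed.

Lemma scan_upd A i t : scan (upd A i t) i = read t.
Proof. by rewrite ffunE /upd eqxx. Qed.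

Lemma runs_rewind A i w j : filled w -> j <= size w ->
  runs (rewind i) (upd A i (word_tape w j)) (j + 3) true
    (upd A i (word_tape w 0)).
Proof.
move=> hw hj.
pose edge : tape void := ([::], blank :: w).
(* [f l] describes the tapes after [l.+1] moves to the left; after [j.+1] moves the head is on the
   blank before the word. *)
pose f l := upd A i (if l < j then word_tape w (j - l.+1) else edge).
have -> : j + 3 = 1 + (j.+1 + 1) by lia.
apply: (@runs_chain _ _ _ _ true (f 0)).
  apply: runs_sweep => //; apply: sweep_upd => /= [|j' _]; last first.
    exact: same_tape_stay.
  rewrite /f {f}; case: j hj => [|j] hj; first exact: move_left0.
  by rewrite subn1; apply: move_left.
apply: (@runs_chain _ _ _ _ true (f j)).
  apply: runs_loop_sweep => [l hl|l i' hl|].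
  - rewrite /nonblank scan_upd hl read_word_tape nonblank_nth //; lia.
  - apply: sweep_upd => /= [|j' _]; last exact: same_tape_stay.
    rewrite hl; case: ltnP => hl'.
      have -> : j - l.+1 = (j - l.+2).+1 by lia.
      apply: move_left; lia.
    have -> : j - l.+1 = 0 by lia.
    exact: move_left0.
  by rewrite /nonblank scan_upd ltnn.
apply: runs_sweep => //; apply: sweep_upd => /= [|j' _]; last first.
  exact: same_tape_stay.
rewrite ltnn /=; split=> n /=; last by rewrite drop0.
by rewrite take0; case: n => [|[|n]].
Qed.

Lemma runs_rewind_from A i w j : filled w -> j <= size w ->
  same_tape (A i) (word_tape w j) ->
  runs (rewind i) A (j + 3) true (upd A i (word_tape w 0)).
Proof.
move=> hw hj hA; apply: runs_weaken (runs_rewind (A := A) (i := i) hw hj) _ _ _ => //.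
  by move=> l; rewrite /upd; case: eqP => // ->.
Qed.

Definition both_right i j := on i (shift Right) (on j (shift Right) idle).

Definition advance i j :=
  loop (sweep (fun a => nonblank i a && nonblank j a) (both_right i j)).

Lemma runs_advance A i j wi wj : i != j -> filled wi -> filled wj ->
  let m := minn (size wi) (size wj) in
  let f l := upd (upd A i (word_tape wi l)) j (word_tape wj l) in
  runs (advance i j) (f 0) m.+1 true (f m).
Proof.
move=> hij fi fj m f.
have sj l : scan (f l) j = nth blank wj l by rewrite scan_upd read_word_tape.
have si l : scan (f l) i = nth blank wi l.
  by rewrite ffunE /f /upd (negPf hij) eqxx read_word_tape.
apply: runs_loop_sweep => [l hl|l i' hl|].
- rewrite /nonblank sj si !nonblank_nth //; lia.
- rewrite /both_right /on /f /upd; case: (eqVneq i' i) => [->|ni].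
    rewrite (negPf hij) move_right //; lia.
  case: eqP => [_|nj]; last exact: same_tape_stay.
  rewrite move_right //; lia.
rewrite /nonblank sj si !nonblank_nth //; lia.
Qed.

(** The heads advance together while both words last, so [p] tests the letter
    of [j] whose index is the length of [i]. *)
Definition probe i j (p : pred sym) :=
  let finish b := chain (rewind i) (chain (rewind j) (ret b)) in
  chain (advance i j)
    (branch (sweep (fun a => p (a j)) idle) (finish true) (finish false)).

Lemma runs_probe A i j (p : pred sym) wi wj : i != j -> filled wi -> filled wj ->
  same_tape (A i) (word_tape wi 0) -> same_tape (A j) (word_tape wj 0) ->
  runs (probe i j p) A (3 * size wi + 9) (p (nth blank wj (size wi))) A.
Proof.
move=> hij fi fj hi hj.
have := runs_advance (A := A) hij fi fj; set m := minn _ _; set f := (fun l : nat => _).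
cbv zeta => adv.
have hA : same_tapes A (f 0).
  by move=> l; rewrite /f /upd; case: eqP => [->//|_]; case: eqP => // ->.
have fin b : runs (chain (rewind i) (chain (rewind j) (ret b))) (f m)
    ((m + 3) + ((m + 3) + 1)) b A.
  apply: runs_chain.
    apply: (@runs_rewind_from _ _ wi m) => //; first by lia.
    by rewrite /f /upd (negPf hij) eqxx.
  apply: runs_chain.
    apply: (@runs_rewind_from _ _ wj m) => //; first by lia.
    by rewrite /f /upd eq_sym (negPf hij) eqxx.
  apply: runs_weaken (@runs_ret _ _) _ _ _ => // l.
  rewrite /f /upd; case: eqP => [->|_]; first exact: same_tape_sym.
  by case: eqP => [->|_ //]; apply: same_tape_sym.
have hp : p (scan (f m) j) = p (nth blank wj (size wi)).
  (* If [wj] ends first, its head reads a blank, which is also the default letter at the index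
     [size wi]. *)
  rewrite scan_upd read_word_tape /m /minn; case: ltnP => // h.
  by rewrite !nth_default.
have {hp} test : runs (sweep (fun a => p (a j)) idle) (f m) 1
    (p (nth blank wj (size wi))) (f m).
  rewrite -hp; case e : (p _); last by apply: runs_sweep_false; rewrite e.
  by apply: runs_sweep => // l; apply: same_tape_stay.
have run : runs (probe i j p) (f 0) (m.+1 + (1 + ((m + 3) + ((m + 3) + 1))))
    (p (nth blank wj (size wi))) A.
  apply: runs_chain adv _; apply: runs_branch test _.
  by case: (p _); apply: fin.
by apply: runs_weaken run _ _ _ => //; rewrite /m; lia.
Qed.

(** * Unary counters *)

Definition one : sym := bit true.
Definition unary c : seq sym := nseq c one.

Lemma filled_unary c : filled (unary c).
Proof. by rewrite /filled all_nseq orbT. Qed.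

Lemma unary_end c : word_tape (unary c) c = (unary c, [::]).
Proof.
by rewrite /word_tape take_oversize ?size_nseq // drop_oversize ?size_nseq //
  /unary rev_nseq.
Qed.

Definition seek_end i := loop (sweep (nonblank i) (on i (shift Right) idle)).

Lemma runs_seek_end A i w : filled w ->
  same_tape (A i) (word_tape w 0) ->
  runs (seek_end i) A (size w).+1 true (upd A i (word_tape w (size w))).
Proof.
move=> fw hA; pose f l := upd A i (word_tape w l).
apply: (@runs_weaken _ (f 0) _ (size w).+1 _ _ (f (size w))) => //; last first.
  by move=> l; rewrite /f /upd; case: eqP => // ->.
apply: runs_loop_sweep => [l hl|l i' hl|].
- by rewrite /nonblank scan_upd read_word_tape nonblank_nth.
- apply: sweep_upd => [|j _]; last exact: same_tape_stay.
  by rewrite move_right.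
- by rewrite /nonblank scan_upd read_word_tape nonblank_nth // ltnn.
Qed.

Lemma runs_seek_end_unary A i c : same_tape (A i) (word_tape (unary c) 0) ->
  runs (seek_end i) A c.+1 true (upd A i (unary c, [::])).
Proof.
move=> hA; have := runs_seek_end (filled_unary c) hA.
by rewrite size_nseq unary_end.
Qed.

Definition push i s := sweep xpredT (on i (put Right s) idle).

Lemma runs_push A i s l :
  same_tape (A i) (l, [::]) ->
  runs (push i s) A 1 true (upd A i (s :: l, [::])).
Proof.
move=> hA; apply: (@runs_weaken _ (upd A i (l, [::])) _ 1) => //; last first.
- by move=> j; rewrite /upd; case: eqP => // ->.
- apply: runs_sweep => // j.
  by apply: sweep_upd => // j' _; apply: same_tape_stay.
Qed.

Lemma runs_rewind_unary A i c : same_tape (A i) (unary c, [::]) ->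
  runs (rewind i) A (c + 3) true (upd A i (word_tape (unary c) 0)).
Proof.
rewrite -unary_end => hA.
by apply: runs_rewind_from hA; rewrite ?filled_unary ?size_nseq.
Qed.

Definition increment i := chain (seek_end i) (chain (push i one) (rewind i)).

Lemma runs_increment A i c : same_tape (A i) (word_tape (unary c) 0) ->
  runs (increment i) A (2 * c + 6) true (upd A i (word_tape (unary c.+1) 0)).
Proof.
move=> hA; have fu := filled_unary.
have -> : 2 * c + 6 = c.+1 + (1 + (c.+1 + 3)) by lia.
apply: runs_chain (runs_seek_end_unary hA) _.
apply: runs_chain.
  apply: runs_push; rewrite /upd eqxx.
  exact: same_tape_refl.
set C := (X in runs _ X _ _ _).
have hC : same_tape (C i) (unary c.+1, [::]).
  by rewrite /C /upd !eqxx; apply: same_tape_refl.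
apply: runs_weaken (runs_rewind_unary hC) _ _ _ => // j.
by rewrite /C /upd; case: eqP.
Qed.

(** The head need not return: an erased tape is blank on both sides of it, and tapes are only
    compared up to blanks. *)
Definition erase i := loop (sweep (nonblank i) (on i (put Right blank) idle)).

Lemma runs_erase A i c : same_tape (A i) (word_tape (unary c) 0) ->
  runs (erase i) A c.+1 true (upd A i (word_tape (unary 0) 0)).
Proof.
move=> hA; pose f l := upd A i (nseq l blank, unary (c - l)).
apply: (@runs_weaken _ (f 0) _ c.+1 _ _ (f c)) => //.
- apply: runs_loop_sweep => [l hl|l i' hl|].
  + rewrite /nonblank scan_upd /read /=; have -> : c - l = (c - l.+1).+1 by lia.
    by [].
  + apply: sweep_upd => [|j _]; last exact: same_tape_stay.
    have -> : c - l = (c - l.+1).+1 by lia.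
    exact: same_tape_refl.
  + by rewrite /nonblank scan_upd subnn.
- move=> j; rewrite /f /upd; case: eqP => [->|//].
  by move: hA; rewrite /word_tape take0 drop0 subn0.
- move=> j; rewrite /f /upd; case: eqP => // _.
  by split=> n; rewrite subnn //= nth_nseq if_same nth_nil.
Qed.

Definition copy b d :=
  loop (sweep (nonblank b) (on b (shift Right) (on d (put Right one) idle))).

Lemma runs_copy A b d cb cd : b != d ->
  same_tape (A b) (word_tape (unary cb) 0) ->
  same_tape (A d) (unary cd, [::]) ->
  runs (copy b d) A cb.+1 true
    (upd (upd A b (word_tape (unary cb) cb)) d (unary (cd + cb), [::])).
Proof.
move=> hbd hb hd.
pose f l := upd (upd A b (word_tape (unary cb) l)) d (unary (cd + l), [::]).
have sb l : scan (f l) b = nth blank (unary cb) l.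
  by rewrite ffunE /f /upd (negPf hbd) eqxx read_word_tape.
have fu := filled_unary.
apply: (@runs_weaken _ (f 0) _ cb.+1 _ _ (f cb)) => //; last first.
  move=> j; rewrite /f /upd addn0; case: eqP => [->//|_].
  by case: eqP => // ->.
apply: runs_loop_sweep => [l hl|l i' hl|].
- by rewrite /nonblank sb nonblank_nth // size_nseq.
- rewrite /on /f /upd; case: (eqVneq i' b) => [->|nb].
    by rewrite (negPf hbd) move_right // size_nseq.
  by case: eqP => [_|nd]; [rewrite addnS | apply: same_tape_stay].
- by rewrite /nonblank sb nonblank_nth // size_nseq ltnn.
Qed.

(** The head of [a] is the loop counter and that of [d] waits at the right end; each cell of [a]
    appends one copy of [b] to [d]. *)
Definition add_product d a b :=
  chain (seek_end d)
  (chain (loop (branch (sweep (nonblank a) (on a (shift Right) idle))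
                  (chain (copy b d) (chain (rewind b) (ret true)))
                  (ret false)))
  (chain (rewind a) (rewind d))).

Lemma runs_add_product A d a b cd ca cb :
  a != b -> a != d -> b != d ->
  same_tape (A a) (word_tape (unary ca) 0) ->
  same_tape (A b) (word_tape (unary cb) 0) ->
  same_tape (A d) (word_tape (unary cd) 0) ->
  runs (add_product d a b) A
    (3 * (ca * cb) + 2 * cd + 7 * ca + 2 * cb + 13) true
    (upd A d (word_tape (unary (cd + ca * cb)) 0)).
Proof.
move=> ab ad bd ha hb hd; have fu := filled_unary.
pose f l := upd (upd A a (word_tape (unary ca) l)) d (unary (cd + l * cb), [::]).
have sa l : scan (f l) a = nth blank (unary ca) l.
  by rewrite ffunE /f /upd (negPf ad) eqxx read_word_tape.
(* One walk to the end of [d], then [ca.+1] rounds of a test followed by copying and rewinding [b],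
   then the rewinding of [a] and [d]. *)
have -> : 3 * (ca * cb) + 2 * cd + 7 * ca + 2 * cb + 13 =
  cd.+1 + (ca.+1 * (1 + (cb.+1 + ((cb + 3) + 1))) + (ca + 3 + (cd + ca * cb + 3))).
  by nia.
apply: runs_chain (runs_seek_end_unary hd) _.
apply: runs_chain.
  apply: (@runs_weaken _ (f 0)); last exact: leqnn.
  - apply: (@runs_loop _ f ca) => [l hl|].
    + apply: (@runs_branch _ _ _ _ _ true).
        apply: (@runs_sweep _ _ _ (upd (f l) a (word_tape (unary ca) l.+1))).
          by rewrite /nonblank sa nonblank_nth // size_nseq.
        move=> j; rewrite /on /f /upd; case: (eqVneq j a) => [->|na].
          by rewrite (negPf ad) move_right // size_nseq.
        exact: same_tape_stay.
      apply: runs_chain.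
        apply: (@runs_copy _ b d cb (cd + l * cb)) => //.
          by rewrite /f /upd eq_sym (negPf ab) (negPf bd).
        rewrite /f /upd eq_sym (negPf ad) eqxx; exact: same_tape_refl.
      apply: runs_chain.
        apply: (@runs_rewind_from _ _ (unary cb) cb) => //.
          by rewrite size_nseq.
        rewrite /upd (negPf bd) eqxx; exact: same_tape_refl.
      apply: runs_weaken (@runs_ret _ _) _ _ _ => // j.
      rewrite /f /upd; case: (eqVneq j b) => [->|nb].
        by rewrite (negPf bd) [b == a]eq_sym (negPf ab); apply: same_tape_sym.
      by rewrite mulSnr addnA; case: eqP => // _; case: eqP.
    + apply: (@runs_weaken _ (f ca) _ (1 + 1)) => //.
      apply: (@runs_branch _ _ _ _ _ false); last exact: runs_ret.
      by apply: runs_sweep_false; rewrite /nonblank sa nonblank_nth // size_nseq ltnn.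
  - move=> j; rewrite /f /upd mul0n addn0.
    by case: eqP => // _; case: eqP => // ->.
  - move=> j; exact: same_tape_refl.
apply: runs_chain.
  apply: (@runs_rewind_from _ _ (unary ca) ca) => //; first by rewrite size_nseq.
  by rewrite /f /upd (negPf ad) eqxx; apply: same_tape_refl.
set C := (X in runs _ X _ _ _).
have hC : same_tape (C d) (unary (cd + ca * cb), [::]).
  by rewrite /C /f /upd eq_sym (negPf ad) eqxx; apply: same_tape_refl.
apply: runs_weaken (runs_rewind_unary hC) _ _ _ => // j.
rewrite /C /f /upd; case: (eqVneq j d) => // _.
by case: eqP => [->|//]; apply: same_tape_sym.
Qed.

End Fragments.

(** * Loop programs *)

(** Variables are de Bruijn levels, [TEx] and [GFor] range over the positions of
    the input, and [TLet c s], [GLet c s] bind [c] plus the sum of the products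
    of the pairs in [s]. *)
Inductive test :=
| TLt (a b : nat)
| TBit (a : nat)
| TNot (t : test)
| TAnd (t1 t2 : test)
| TEx (t : test)
| TLet (c : nat) (s : seq (nat * nat)) (t : test).

Inductive gen :=
| GNil
| GEmit (b : bool)
| GCat (g1 g2 : gen)
| GIf (t : test) (g1 g2 : gen)
| GFor (g : gen)
| GLet (c : nat) (s : seq (nat * nat)) (g : gen).

Definition value (env : seq nat) c (s : seq (nat * nat)) : nat :=
  c + sumn [seq nth 0 env p.1 * nth 0 env p.2 | p <- s].

Fixpoint eval_test (x : seq bool) (env : seq nat) (t : test) : bool :=
  match t with
  | TLt a b => nth 0 env a < nth 0 env b
  | TBit a => nth false x (nth 0 env a)
  | TNot t => ~~ eval_test x env t
  | TAnd t1 t2 => eval_test x env t1 && eval_test x env t2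
  | TEx t => has (fun v => eval_test x (rcons env v) t) (iota 0 (size x))
  | TLet c s t => eval_test x (rcons env (value env c s)) t
  end.

Fixpoint eval (x : seq bool) (env : seq nat) (g : gen) : seq bool :=
  match g with
  | GNil => [::]
  | GEmit b => [:: b]
  | GCat g1 g2 => eval x env g1 ++ eval x env g2
  | GIf t g1 g2 => if eval_test x env t then eval x env g1 else eval x env g2
  | GFor g => flatten [seq eval x (rcons env v) g | v <- iota 0 (size x)]
  | GLet c s g => eval x (rcons env (value env c s)) g
  end.

Definition polynomial (f : nat -> nat) :=
  exists p : {poly nat}, forall n, f n = p.[n]%R.

Lemma polynomial_const c : polynomial (fun=> c).
Proof. by exists (c%:P)%R => n; rewrite hornerC. Qed.

Lemma polynomial_id : polynomial id.
Proof. by exists 'X%R => n; rewrite hornerX. Qed.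

Lemma polynomial_add f g :
  polynomial f -> polynomial g -> polynomial (fun n => f n + g n).
Proof. by move=> [p hp] [q hq]; exists (p + q)%R => n; rewrite hornerD hp hq. Qed.

Lemma polynomial_mul f g :
  polynomial f -> polynomial g -> polynomial (fun n => f n * g n).
Proof. by move=> [p hp] [q hq]; exists (p * q)%R => n; rewrite hornerM hp hq. Qed.

(** Composition is what bindings need: the body of a [TLet] or [GLet] runs under a bound on its
    variables that is a polynomial in the old bound. *)
Lemma polynomial_comp f g :
  polynomial f -> polynomial g -> polynomial (fun n => f (g n)).
Proof. by move=> [p hp] [q hq]; exists (p \Po q)%R => n; rewrite horner_comp hp hq. Qed.

Ltac polynomial_tac := repeat first
  [ assumption | apply: polynomial_add | apply: polynomial_mul
  | apply: polynomial_const | exact: polynomial_id | apply: polynomial_comp ].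

Definition bits (x : seq bool) : seq (symbol void) := [seq bit b | b <- x].

Lemma size_bits x : size (bits x) = size x.
Proof. exact: size_map. Qed.

(** * Compiling loop programs to fragments *)

Section Compilation.

Variable D : nat.
Local Notation I := 'I_D.+2.

Definition reg (r : nat) : I := inord r.+1.
Local Notation input := (ord0 : I).
Local Notation out := (ord_max : I).

(** Registers beyond the length of [env] are empty. *)
Definition store (x : seq bool) (env : seq nat) (o : seq bool) : I -> tape void :=
  fun i => if i == input then word_tape (bits x) 0
           else if i == out then (rev (bits o), [::])
           else word_tape (unary (nth 0 env i.-1)) 0.

(** Factors are distinct because multiplication walks both registers at once. *)
Definition wf_sum d (s : seq (nat * nat)) :=
  all (fun p => [&& p.1 < d, p.2 < d & p.1 != p.2]) s && (d < D).

Fixpoint wf_test d t :=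
  match t with
  | TLt a b => [&& a < d, b < d & a != b]
  | TBit a => a < d
  | TNot t => wf_test d t
  | TAnd t1 t2 => wf_test d t1 && wf_test d t2
  | TEx t => (d < D) && wf_test d.+1 t
  | TLet c s t => wf_sum d s && wf_test d.+1 t
  end.

Fixpoint wf d g :=
  match g with
  | GNil | GEmit _ => true
  | GCat g1 g2 => wf d g1 && wf d g2
  | GIf t g1 g2 => [&& wf_test d t, wf d g1 & wf d g2]
  | GFor g => (d < D) && wf d.+1 g
  | GLet c s g => wf_sum d s && wf d.+1 g
  end.

Definition load d c (s : seq (nat * nat)) : fragment D.+1 :=
  foldr (fun p F => chain (add_product (reg d) (reg p.1) (reg p.2)) F)
    (iter c (chain (increment (reg d))) (ret D.+1 true)) s.

(** The input tape serves as its own bound: the cell at index [v] is blank exactly when [v] is past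
    the end, so the length of the input is never stored. *)
Definition in_range d : fragment D.+1 := probe (reg d) input (predC1 blank).

(** Closing a scope empties its register, which restores the convention of [store], and passes on
    the result [b] of the scope. *)
Definition release d b : fragment D.+1 := chain (erase (reg d)) (ret D.+1 b).

(** For [TEx] the loop stops at the first witness, or else when the register leaves the range.
    Whether a witness exists can therefore be seen afterwards by testing the range once more. *)
Fixpoint compile_test d (t : test) : fragment D.+1 :=
  match t with
  | TLt a b => probe (reg a) (reg b) (predC1 blank)
  | TBit a => probe (reg a) input (pred1 one)
  | TNot t => branch (compile_test d t) (ret D.+1 false) (ret D.+1 true)
  | TAnd t1 t2 => branch (compile_test d t1) (compile_test d t2) (ret D.+1 false)
  | TEx t =>
      chain (loop (branch (in_range d)
                     (branch (compile_test d.+1 t) (ret D.+1 false)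
                        (chain (increment (reg d)) (ret D.+1 true)))
                     (ret D.+1 false)))
        (branch (in_range d) (release d true) (release d false))
  | TLet c s t =>
      chain (load d c s)
        (branch (compile_test d.+1 t) (release d true) (release d false))
  end.

Fixpoint compile d (g : gen) : fragment D.+1 :=
  match g with
  | GNil => ret D.+1 true
  | GEmit b => push out (bit b)
  | GCat g1 g2 => chain (compile d g1) (compile d g2)
  | GIf t g1 g2 => branch (compile_test d t) (compile d g1) (compile d g2)
  | GFor g =>
      chain (loop (branch (in_range d)
                     (chain (compile d.+1 g)
                        (chain (increment (reg d)) (ret D.+1 true)))
                     (ret D.+1 false)))
        (release d true)
  | GLet c s g => chain (load d c s) (chain (compile d.+1 g) (release d true))
  end.

Lemma val_reg r : r < D -> reg r = r.+1 :> nat.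
Proof. by move=> h; rewrite inordK // ltnS; lia. Qed.

Lemma reg_neq_input r : r < D -> reg r != input.
Proof. by move=> h; rewrite -val_eqE /= val_reg. Qed.

Lemma reg_neq_out r : r < D -> reg r != out.
Proof. by move=> h; rewrite -val_eqE /= val_reg //; lia. Qed.

Lemma reg_eq r r' : r < D -> r' < D -> (reg r == reg r') = (r == r').
Proof. by move=> h h'; rewrite -val_eqE /= !val_reg. Qed.

Lemma store_reg x env o r :
  r < D -> store x env o (reg r) = word_tape (unary (nth 0 env r)) 0.
Proof.
move=> h; rewrite /store (negPf (reg_neq_input h)) (negPf (reg_neq_out h)).
by rewrite val_reg.
Qed.

Lemma filled_bits x : filled (bits x).
Proof. by apply/allP=> s /mapP[b _ ->]. Qed.

Lemma store_ext x env env' o :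
  (forall r, r < D -> nth 0 env r = nth 0 env' r) ->
  same_tapes (store x env o) (store x env' o).
Proof.
move=> h i; rewrite /store; case: ifP => // hi; case: ifP => // ho.
rewrite h; first exact: same_tape_refl.
have := ltn_ord i; have : i != 0 :> nat by rewrite -val_eqE /= in hi; rewrite hi.
have : i != D.+1 :> nat by rewrite -val_eqE /= in ho; rewrite ho.
lia.
Qed.

Lemma upd_store x env v v' o : size env < D ->
  same_tapes
    (upd (store x (rcons env v) o) (reg (size env)) (word_tape (unary v') 0))
    (store x (rcons env v') o).
Proof.
move=> h i; rewrite /upd; case: eqP => [->|ni].
  by rewrite store_reg // nth_rcons ltnn eqxx; apply: same_tape_refl.
rewrite /store; case: ifP => // hi; case: ifP => // ho.
rewrite !nth_rcons; case: ltnP => // _; case: eqP => // e.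
case: ni; apply: val_inj => /=; rewrite val_reg // -e.
by rewrite -val_eqE /= in hi; lia.
Qed.

Lemma rcons_store x env o :
  same_tapes (store x env o) (store x (rcons env 0) o).
Proof.
apply: store_ext => r _; rewrite nth_rcons; case: ltnP => // h.
by rewrite nth_default // if_same.
Qed.

Lemma nth_rcons_last env v : nth 0 (rcons env v) (size env) = v.
Proof. by rewrite nth_rcons ltnn eqxx. Qed.

Lemma store_last x env v o : size env < D ->
  same_tape (store x (rcons env v) o (reg (size env))) (word_tape (unary v) 0).
Proof.
by move=> h; rewrite store_reg // nth_rcons_last; apply: same_tape_refl.
Qed.

Lemma runs_store_increment x env v o : size env < D ->
  runs (increment (reg (size env))) (store x (rcons env v) o) (2 * v + 6) true
    (store x (rcons env v.+1) o).
Proof.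
move=> h; apply: runs_weaken (runs_increment (store_last x v o h)) _ _ _ => //.
exact: upd_store.
Qed.

Lemma runs_release x env v b o : size env < D ->
  runs (release (size env) b) (store x (rcons env v) o) (v + 2) b
    (store x env o).
Proof.
move=> h; have -> : v + 2 = v.+1 + 1 by lia.
apply: runs_chain (runs_erase (store_last x v o h)) _.
apply: runs_weaken (@runs_ret _ b _) _ _ _ => // i.
apply: same_tape_trans (upd_store _ _ _ _ h i) _.
exact: same_tape_sym (rcons_store _ _ _ _).
Qed.

Lemma runs_in_range x env v o : size env < D ->
  runs (in_range (size env)) (store x (rcons env v) o) (3 * v + 9)
    (v < size x) (store x (rcons env v) o).
Proof.
move=> h; have := @runs_probe _ (store x (rcons env v) o) (reg (size env)) input
  (predC1 blank) (unary v) (bits x) (reg_neq_input h)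
  (filled_unary v) (filled_bits x) (store_last x v o h) (same_tape_refl _).
have := nonblank_nth v (filled_bits x); rewrite size_bits => <-.
by rewrite size_nseq => run; apply: runs_weaken run _ _ _.
Qed.

Definition bounded B (env : seq nat) := all (fun v => v <= B) env.

Lemma nth_bounded B env r : bounded B env -> nth 0 env r <= B.
Proof.
move=> /allP h; case: (ltnP r (size env)) => hr; last by rewrite nth_default.
by apply: h; rewrite mem_nth.
Qed.

Lemma bounded_rcons B env v : bounded B (rcons env v) = (v <= B) && bounded B env.
Proof. exact: all_rcons. Qed.

Lemma bounded_leq B B' env : B <= B' -> bounded B env -> bounded B' env.
Proof. by move=> h; apply: sub_all => v /= hv; apply: leq_trans hv h. Qed.

Lemma value_cons env c p s :
  value env c (p :: s) = nth 0 env p.1 * nth 0 env p.2 + value env c s.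
Proof. by rewrite /value /= addnCA. Qed.

Lemma value_bounded B env c s :
  bounded B env -> value env c s <= c + size s * (B * B).
Proof.
move=> hB; elim: s => [|p s ih]; first by rewrite /value /= mul0n.
rewrite value_cons /= mulSn addnCA leq_add //.
by rewrite leq_mul ?nth_bounded.
Qed.

Lemma runs_increments x env c v V o : size env < D -> v + c <= V ->
  runs (iter c (chain (increment (reg (size env)))) (ret D.+1 true))
    (store x (rcons env v) o) (c * (2 * V + 6) + 1) true
    (store x (rcons env (v + c)) o).
Proof.
move=> h; elim: c v => [|c ih] v hV.
  by rewrite addn0; apply: runs_ret.
have run := runs_chain (@runs_store_increment x env v o h) (ih v.+1 _).
rewrite addSnnS in run; rewrite /=; apply: runs_weaken (run hV) _ _ _ => //.
by rewrite mulSn; lia.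
Qed.

Lemma runs_store_product x env a b v o :
  size env < D -> a < size env -> b < size env -> a != b ->
  let ca := nth 0 env a in let cb := nth 0 env b in
  runs (add_product (reg (size env)) (reg a) (reg b)) (store x (rcons env v) o)
    (3 * (ca * cb) + 2 * v + 7 * ca + 2 * cb + 13) true
    (store x (rcons env (v + ca * cb)) o).
Proof.
move=> hD ha hb ab ca cb; have aD := ltn_trans ha hD; have bD := ltn_trans hb hD.
have sr r : r < size env -> same_tape (store x (rcons env v) o (reg r))
    (word_tape (unary (nth 0 env r)) 0).
  move=> hr; rewrite store_reg ?(ltn_trans hr hD) // nth_rcons hr.
  exact: same_tape_refl.
apply: runs_weaken; first apply: (@runs_add_product _ _ _ _ _ v ca cb).
- by rewrite reg_eq.
- by rewrite reg_eq // neq_ltn ha.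
- by rewrite reg_eq // neq_ltn hb.
- exact: sr.
- exact: sr.
- exact: store_last.
- by move=> i; apply: same_tape_refl.
- exact: upd_store.
- by [].
Qed.

Lemma runs_load x env c s v V B o :
  wf_sum (size env) s -> bounded B env -> v + value env c s <= V ->
  runs (load (size env) c s) (store x (rcons env v) o)
    (size s * (3 * (B * B) + 2 * V + 9 * B + 13) + (c * (2 * V + 6) + 1)) true
    (store x (rcons env (v + value env c s)) o).
Proof.
case/andP=> hs hD hB; elim: s hs v => [|p s ih] /= hs v hV.
  rewrite mul0n add0n; move: hV; rewrite /value /= addn0; exact: runs_increments.
case/andP: hs => /and3P[p1 p2 p12] hs; rewrite value_cons in hV *.
have n1 : nth 0 env p.1 <= B by apply: nth_bounded.
have n2 : nth 0 env p.2 <= B by apply: nth_bounded.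
have n12 : nth 0 env p.1 * nth 0 env p.2 <= B * B by apply: leq_mul.
rewrite mulSn addnA in hV *; rewrite -addnA.
apply: runs_chain; last by apply: ih.
apply: runs_weaken (@runs_store_product x env p.1 p.2 v o _ _ _ _) _ _ _ => //.
lia.
Qed.

Definition time_load c n B :=
  let V := c + n * (B * B) in
  n * (3 * (B * B) + 2 * V + 9 * B + 13) + (c * (2 * V + 6) + 1).

Lemma runs_load0 x env c s B o :
  wf_sum (size env) s -> bounded B env ->
  runs (load (size env) c s) (store x env o) (time_load c (size s) B) true
    (store x (rcons env (value env c s)) o).
Proof.
move=> hs hB; apply: runs_weaken.
- apply: (@runs_load x env c s 0 (c + size s * (B * B)) B o) => //.
  exact: value_bounded.
- exact: rcons_store.
- by move=> i; apply: same_tape_refl.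
- by [].
Qed.

Lemma runs_in_range_bounded x env v B o : size env < D -> v <= B ->
  runs (in_range (size env)) (store x (rcons env v) o) (3 * B + 9)
    (v < size x) (store x (rcons env v) o).
Proof.
move=> h hv; apply: runs_weaken (@runs_in_range x env v o h) _ _ _ => //; lia.
Qed.

Lemma runs_next x env v B o : size env < D -> v <= B ->
  runs (chain (increment (reg (size env))) (ret D.+1 true))
    (store x (rcons env v) o) (2 * B + 7) true (store x (rcons env v.+1) o).
Proof.
move=> h hv; have := runs_chain (@runs_store_increment x env v o h)
  (@runs_ret _ true _); move=> run; apply: runs_weaken run _ _ _ => //; lia.
Qed.

Lemma runs_release_bounded x env v b B o : size env < D -> v <= B ->
  runs (release (size env) b) (store x (rcons env v) o) (B + 2) b (store x env o).
Proof.
move=> h hv; apply: runs_weaken (@runs_release x env v b o h) _ _ _ => //; lia.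
Qed.

(** The induction needs a time bound in terms of a common bound [B] on the input length and on all
    current values: bindings create values larger than the input length. *)
Lemma runs_compile_test t d : wf_test d t -> d <= D ->
  exists2 f, polynomial f & forall x env o B,
    size env = d -> size x <= B -> bounded B env ->
    runs (compile_test d t) (store x env o) (f B) (eval_test x env t)
      (store x env o).
Proof.
elim: t d => [a b|a|t ih|t1 ih1 t2 ih2|t ih|c s t ih] d /=.
- case/and3P=> ha hb ab hd; exists (fun B => 3 * B + 9); first by polynomial_tac.
  move=> x env o B ed xB envB.
  have aD := leq_trans ha hd; have bD := leq_trans hb hd.
  have rab : reg a != reg b by rewrite reg_eq.
  have sr r : r < D -> same_tape (store x env o (reg r))
      (word_tape (unary (nth 0 env r)) 0).
    by move=> hr; rewrite store_reg //; apply: same_tape_refl.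
  have := @runs_probe _ _ _ _ (predC1 blank) _ _ rab (filled_unary _)
    (filled_unary _) (sr a aD) (sr b bD).
  have := nonblank_nth (nth 0 env a) (filled_unary (nth 0 env b)).
  rewrite !size_nseq /= => -> run; apply: runs_weaken run _ _ _ => //.
  by have := nth_bounded a envB; lia.
- move=> ha hd; exists (fun B => 3 * B + 9); first by polynomial_tac.
  move=> x env o B ed xB envB; have aD := leq_trans ha hd.
  have := @runs_probe _ (store x env o) (reg a) input (pred1 one)
    (unary (nth 0 env a)) (bits x) (reg_neq_input aD)
    (filled_unary _) (filled_bits x) _ (same_tape_refl _).
  have -> : pred1 one (nth blank (bits x)
      (size (unary (nth 0 env a)))) = nth false x (nth 0 env a).
    rewrite size_nseq /=; case: (ltnP (nth 0 env a) (size x)) => h.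
      by rewrite /bits (nth_map false) //; case: nth.
    by rewrite (nth_default blank) ?size_bits // (nth_default false).
  rewrite size_nseq => run; apply: runs_weaken (run _) _ _ _ => //.
    by rewrite store_reg //; apply: same_tape_refl.
  by have := nth_bounded a envB; lia.
- move=> ht hd; have [f pf hf] := ih d ht hd.
  exists (fun B => f B + 1); first by polynomial_tac.
  move=> x env o B ed xB envB; apply: runs_branch (hf _ _ _ _ ed xB envB) _.
  by case: eval_test; apply: runs_ret.
- case/andP=> ht1 ht2 hd.
  have [f1 pf1 hf1] := ih1 d ht1 hd; have [f2 pf2 hf2] := ih2 d ht2 hd.
  exists (fun B => f1 B + (f2 B + 1)); first by polynomial_tac.
  move=> x env o B ed xB envB; apply: runs_branch (hf1 _ _ _ _ ed xB envB) _.
  case: eval_test => /=.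
    apply: runs_weaken (hf2 _ _ _ _ ed xB envB) _ _ _ => //; lia.
  apply: runs_weaken (@runs_ret _ false _) _ _ _ => //; lia.
- case/andP=> hD ht _; have [f pf hf] := ih d.+1 ht hD.
  pose body B := (3 * B + 9) + (f B + (2 * B + 7)).
  exists (fun B => (B + 1) * body B + ((3 * B + 9) + (B + 2))).
    by rewrite /body; polynomial_tac.
  move=> x env o B ed xB envB; subst d.
  (* [n] is the first witness, or [size x] if there is none; the loop ends with [n] in the
     register. *)
  set P := (fun v => _); pose n := find P (iota 0 (size x)).
  have nx : n <= size x by rewrite -[X in _ <= X](size_iota 0) find_size.
  have Pbefore j : j < n -> P j = false.
    move=> hj; have := before_find 0 hj.
    by rewrite nth_iota // (leq_trans hj nx).
  have Pn : n < size x -> P n.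
    move=> hn; have := nth_find 0 (a := P) (s := iota 0 (size x)).
    by rewrite has_find size_iota -/n nth_iota // add0n; apply.
  have envj v : v <= B -> bounded B (rcons env v) by rewrite bounded_rcons => ->.
  have test v : v <= B ->
      runs (compile_test (size env).+1 t) (store x (rcons env v) o) (f B) (P v)
        (store x (rcons env v) o).
    by move=> hv; apply: hf; rewrite ?size_rcons ?envj.
  have hn : n <= B by apply: leq_trans nx xB.
  apply: (@runs_chain _ _ _ _ _ true (store x (rcons env n) o)).
    apply: (@runs_weaken _ _ (store x (rcons env 0) o) _ (n.+1 * body B)); first last.
    - by rewrite leq_mul2r addn1 ltnS hn orbT.
    - by move=> i; apply: same_tape_refl.
    - exact: rcons_store.
    apply: (@runs_loop _ _ (fun j => store x (rcons env j) o)) => [j hj|].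
      have jB : j <= B by apply: leq_trans (ltnW hj) hn.
      have := @runs_in_range_bounded x _ _ B o hD jB.
      rewrite (leq_trans hj nx) => run; apply: runs_branch run _.
      have := test j jB; rewrite (Pbefore j hj) => run; apply: runs_branch run _.
      exact: runs_next.
    have := @runs_in_range_bounded x _ _ B o hD hn.
    case: ltnP => h run; apply: runs_branch run _.
      have := test n hn; rewrite (Pn h) => run'; apply: runs_branch run' _.
      by apply: runs_weaken (@runs_ret _ false _) _ _ _ => //; lia.
    by apply: runs_weaken (@runs_ret _ false _) _ _ _ => //; lia.
  rewrite has_find -/n size_iota.
  apply: runs_branch (@runs_in_range_bounded x _ _ B o hD hn) _.
  by case: ltnP => _; apply: runs_release_bounded.
- case/andP=> hs ht _; have /andP[_ hD] := hs.
  have [f pf hf] := ih d.+1 ht hD.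
  (* [V B] bounds the new value, the old values and the input length at once. *)
  pose V B := B + (c + size s * (B * B)).
  exists (fun B => time_load c (size s) B + (f (V B) + (V B + 2))).
    by rewrite /V /time_load; polynomial_tac.
  move=> x env o B ed xB envB; subst d.
  have hv : value env c s <= V B.
    by apply: leq_trans (value_bounded c s envB) _; rewrite /V leq_addl.
  have BV : B <= V B by rewrite /V leq_addr.
  apply: runs_chain (@runs_load0 x _ c s B o hs envB) _.
  apply: runs_branch; first apply: hf.
  + by rewrite size_rcons.
  + exact: leq_trans xB BV.
  + by rewrite bounded_rcons hv (bounded_leq BV).
  + by case: eval_test; apply: runs_release_bounded.
Qed.

(** The length of the output is bounded together with the time, because the output tape has to be
    rewound at the very end. *)
Lemma runs_compile g d : wf d g -> d <= D ->
  exists2 f, polynomial f & forall x env o B,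
    size env = d -> size x <= B -> bounded B env ->
    size (eval x env g) <= f B /\
    runs (compile d g) (store x env o) (f B) true
      (store x env (o ++ eval x env g)).
Proof.
elim: g d => [|b|g1 ih1 g2 ih2|t g1 ih1 g2 ih2|g ih|c s g ih] d /=.
- move=> _ _; exists (fun=> 1); first by polynomial_tac.
  by move=> x env o B _ _ _; split=> //; rewrite cats0; apply: runs_ret.
- move=> _ _; exists (fun=> 1); first by polynomial_tac.
  move=> x env o B _ _ _; split=> //.
  have h : same_tape (store x env o out) (rev (bits o), [::]).
    by rewrite /store eqxx; apply: same_tape_refl.
  apply: runs_weaken (runs_push (bit b) h) _ _ _ => // i.
  rewrite /upd /store; case: (eqVneq i out) => // ->.
  by rewrite /bits map_cat rev_cat.
- case/andP=> hg1 hg2 hd.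
  have [f1 pf1 hf1] := ih1 d hg1 hd; have [f2 pf2 hf2] := ih2 d hg2 hd.
  exists (fun B => f1 B + f2 B); first by polynomial_tac.
  move=> x env o B ed xB envB; rewrite size_cat catA.
  have [s1 r1] := hf1 x env o B ed xB envB.
  have [s2 r2] := hf2 x env (o ++ eval x env g1) B ed xB envB.
  by split; [apply: leq_add | apply: runs_chain r1 r2].
- case/and3P=> ht hg1 hg2 hd; have [f pf hf] := runs_compile_test ht hd.
  have [f1 pf1 hf1] := ih1 d hg1 hd; have [f2 pf2 hf2] := ih2 d hg2 hd.
  exists (fun B => f B + (f1 B + f2 B)); first by polynomial_tac.
  move=> x env o B ed xB envB.
  have [s1 r1] := hf1 x env o B ed xB envB.
  have [s2 r2] := hf2 x env o B ed xB envB.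
  have run := hf x env o B ed xB envB.
  case: eval_test run => run; split.
  + by apply: leq_trans s1 _; lia.
  + apply: runs_branch run _; apply: runs_weaken r1 _ _ _ => //; lia.
  + by apply: leq_trans s2 _; lia.
  + apply: runs_branch run _; apply: runs_weaken r2 _ _ _ => //; lia.
- case/andP=> hD hg _; have [f pf hf] := ih d.+1 hg hD.
  pose body B := (3 * B + 9) + (f B + (2 * B + 7)).
  exists (fun B => (B + 1) * body B + (B + 2)); first by rewrite /body; polynomial_tac.
  move=> x env o B ed xB envB; subst d.
  have envj v : v <= B -> bounded B (rcons env v) by rewrite bounded_rcons => ->.
  pose w j := flatten [seq eval x (rcons env v) g | v <- iota 0 j].
  have wS j : w j.+1 = w j ++ eval x (rcons env j) g.
    by rewrite /w -addn1 iotaD map_cat flatten_cat /= cats0.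
  have run v o' : v <= B -> size (eval x (rcons env v) g) <= f B /\
      runs (compile (size env).+1 g) (store x (rcons env v) o') (f B) true
        (store x (rcons env v) (o' ++ eval x (rcons env v) g)).
    by move=> hv; apply: hf; rewrite ?size_rcons ?envj.
  rewrite -/(w (size x)); split.
    have sw j : j <= B -> size (w j) <= j * f B.
      elim: j => // j ihj jB; rewrite wS size_cat mulSnr.
      by apply: leq_add; [apply/ihj/ltnW | case: (run j [::] (ltnW jB))].
    apply: leq_trans (sw _ xB) _; apply: leq_trans (leq_addr _ _).
    by rewrite leq_mul /body //; lia.
  apply: (@runs_chain _ _ _ _ _ true (store x (rcons env (size x)) (o ++ w (size x)))).
    apply: (@runs_weaken _ _ (store x (rcons env 0) (o ++ w 0)) _
      ((size x).+1 * body B)); first last.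
    - by rewrite leq_mul2r addn1 ltnS xB orbT.
    - by move=> i; apply: same_tape_refl.
    - by rewrite /w /= cats0; apply: rcons_store.
    apply: (@runs_loop _ _ (fun j => store x (rcons env j) (o ++ w j))) => [j hj|].
      have jB : j <= B by apply: leq_trans (ltnW hj) xB.
      have := @runs_in_range_bounded x _ _ B (o ++ w j) hD jB.
      rewrite hj => r; apply: runs_branch r _.
      rewrite wS catA; apply: runs_chain; first exact: (run j (o ++ w j) jB).2.
      exact: runs_next.
    have := @runs_in_range_bounded x _ _ B (o ++ w (size x)) hD xB.
    rewrite ltnn => r; apply: runs_branch r _.
    by apply: runs_weaken (@runs_ret _ false _) _ _ _ => //; lia.
  exact: runs_release_bounded.
- case/andP=> hs hg _; have /andP[_ hD] := hs.
  have [f pf hf] := ih d.+1 hg hD.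
  pose V B := B + (c + size s * (B * B)).
  exists (fun B => time_load c (size s) B + (f (V B) + (V B + 2))).
    by rewrite /V /time_load; polynomial_tac.
  move=> x env o B ed xB envB; subst d.
  have hv : value env c s <= V B.
    by apply: leq_trans (value_bounded c s envB) _; rewrite /V leq_addl.
  have BV : B <= V B by rewrite /V leq_addr.
  have [sz run] : size (eval x (rcons env (value env c s)) g) <= f (V B) /\
      runs (compile (size env).+1 g) (store x (rcons env (value env c s)) o)
        (f (V B)) true (store x (rcons env (value env c s))
          (o ++ eval x (rcons env (value env c s)) g)).
    apply: hf; rewrite ?size_rcons ?bounded_rcons ?hv ?(bounded_leq BV) //.
    exact: leq_trans xB BV.
  split; first by lia.
  apply: runs_chain (@runs_load0 x _ c s B o hs envB) _.
  by apply: runs_chain run _; apply: runs_release_bounded.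
Qed.

End Compilation.

(** * From fragments to machines *)

Section Execution.

Variables (k : nat) (F : fragment k).

Definition machine_of : machine :=
  @Machine k void (node F + bool)%type (inl (entry F))
    (fun q => if q is inr _ then true else false)
    (fun q a => match q with
                | inl q => delta q a
                | inr b => (inr b, fun i => (a i, Stay))
                end).

Lemma iter_machine_of q T t b T' : @exec k F q T t b T' ->
  iter t (@step machine_of) (inl q, T) = (inr b, T').
Proof.
elim=> {q T t b T'} [q T b a h|q T q' a t b T' h _ ih].
  by rewrite /= /step /= -/(scan T) h.
by rewrite iterSr -ih /step /= -/(scan T) h.
Qed.

Lemma runs_machine_of A t b B T : runs F A t b B -> same_tapes T A ->
  exists2 T', same_tapes T' B &
    iter t (@step machine_of) (inl (entry F), T) = (inr b, T').
Proof.
move=> run /run[t' [T' [ht hT' /iter_machine_of e]]]; exists T' => //.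
(* The run may end before the bound; a halted configuration is fixed by the remaining steps. *)
rewrite -(subnKC ht) addnC iterD e.
by elim: (t - t') => // n ih; rewrite iterS ih.
Qed.

End Execution.

(** Reading the output stops at the first blank, so unlisted blanks cannot affect it. *)
Lemma bits_prefix_same (s s' : seq (symbol void)) :
  (forall n, nth blank s n = nth blank s' n) -> bits_prefix s = bits_prefix s'.
Proof.
elim: s s' => [|a s ih] [|a' s'] h //=.
- by have /= <- := h 0.
- by have /= -> := h 0.
have /= <- := h 0; rewrite (ih s') // => n; exact: (h n.+1).
Qed.

Lemma bits_prefix_bits (o : seq bool) :
  bits_prefix (bits o) = o.
Proof. by elim: o => //= b o ->. Qed.

Theorem eval_polytime D g : wf D 0 g -> polytime (fun x => eval x [::] g).
Proof.
move=> hg; have [f pf hf] := runs_compile hg (leq0n D).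
(* The program leaves the output head behind the last letter, whereas the output of a machine is
   read from the head rightwards. *)
pose F := chain (compile D 0 g) (rewind ord_max).
have [p hp] : polynomial (fun B => f B + (f B + 3)) by polynomial_tac.
exists (machine_of F), p => x; rewrite -hp.
have [sz run] := hf x [::] [::] (size x) erefl (leqnn _) isT.
have outx : same_tape (@store D x [::] (eval x [::] g) ord_max)
    (word_tape (bits (eval x [::] g)) (size (eval x [::] g))).
  rewrite /word_tape -size_bits take_size drop_size /store eqxx.
  exact: same_tape_refl.
have hrew := runs_rewind_from (filled_bits _) _ outx.
have init_store : same_tapes (init (machine_of F) x).2 (@store D x [::] [::]).
  move=> i; rewrite /init /store /=; case: eqP => _.
    by rewrite /word_tape take0 drop0; apply: same_tape_refl.
  case: eqP => _; first exact: same_tape_refl.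
  by rewrite nth_nil; apply: same_tape_refl.
have := runs_chain run (hrew _); rewrite size_bits => run'.
have {}run' := runs_weaken (run' (leqnn _)) (fun i => same_tape_refl _)
  (fun i => same_tape_refl _) (_ : _ <= f (size x) + (f (size x) + 3)).
have [|T' hT' e] := runs_machine_of (run' _) init_store; first by lia.
rewrite /computes_within.
rewrite [init _ _](_ : _ = (inl (entry F), (init (machine_of F) x).2)) //.
rewrite e; split=> //; rewrite /output /=.
have [_ h] := hT' ord_max; rewrite (bits_prefix_same h) /upd eqxx /= drop0.
exact: bits_prefix_bits.
Qed.

(** * Parsing pairs of graphs *)

Definition matrix_at (x : seq bool) (o n : nat) : rel 'I_n :=
  fun i j => nth false x (o + (i * n + j)).

Lemma matrix_at_take x o p n : o + p * n <= size x ->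
  [seq nth false x (o + (i * n + j)) | i <- iota 0 p, j <- iota 0 n] =
  take (p * n) (drop o x).
Proof.
elim: p => [|p ih] h; first by rewrite mul0n take0.
have hp : p * n + n <= size (drop o x) by rewrite size_drop; lia.
rewrite -addn1 iotaD allpairs_cat ih; last by lia.
rewrite addn1 mulSnr takeD /= cats0; congr cat.
rewrite -(map_nth_iota false); last by rewrite size_drop in hp *; lia.
rewrite -[p * n]addn0 iotaDl -map_comp; apply: eq_map => j /=.
by rewrite nth_drop addn0.
Qed.

Lemma enum_ordE n : map (@nat_of_ord n) (enum 'I_n) = iota 0 n.
Proof. exact: val_enum_ord. Qed.

Lemma encode_matrix_at x o n : o + n * n <= size x ->
  encode (matrix_at x o (n := n)) = nseq n true ++ false :: take (n * n) (drop o x).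
Proof.
move=> h; rewrite /encode -(matrix_at_take h) -enum_ordE.
by rewrite allpairs_mapl allpairs_mapr.
Qed.

Lemma size_encode n (e : rel 'I_n) : size (encode e) = n + (n * n).+1.
Proof.
by rewrite /encode size_cat size_nseq /= size_allpairs size_enum_ord.
Qed.

Lemma nth_encode n (e : rel 'I_n) k : k <= n -> nth false (encode e) k = (k < n).
Proof.
rewrite leq_eqVlt /encode nth_cat size_nseq.
case/predU1P => [->|h]; first by rewrite ltnn subnn.
by rewrite h nth_nseq h.
Qed.

Lemma nseq_cons_inj n m (s t : seq bool) :
  nseq n true ++ false :: s = nseq m true ++ false :: t -> n = m /\ s = t.
Proof.
elim: n m => [|n ih] [|m] //=; first by case.
by case=> /ih[-> ->].
Qed.

Lemma eq_allpairs_in (T : eqType) (e e' : rel T) (s t : seq T) :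
  [seq e i j | i <- s, j <- t] = [seq e' i j | i <- s, j <- t] ->
  {in s & t, e =2 e'}.
Proof.
elim: s => [|k s ih] //= /eqP; rewrite eqseq_cat ?size_map //.
case/andP=> /eqP/eq_in_map hk /eqP/ih h i j; rewrite inE.
by case/predU1P => [->|] *; [apply: hk | apply: h].
Qed.

(** The first zero determines the number of vertices and thus the length of the matrix, so no
    encoding is a proper prefix of another. *)
Lemma encode_cat_inj n m (e : rel 'I_n) (e' : rel 'I_m) s s' :
  encode e ++ s = encode e' ++ s' ->
  exists en : n = m, (forall i j, e' (cast_ord en i) (cast_ord en j) = e i j) /\ s = s'.
Proof.
rewrite /encode -!catA !cat_cons => /nseq_cons_inj[en].
subst m => /eqP h0; exists erefl; move: h0; rewrite eqseq_cat ?size_allpairs //.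
case/andP=> /eqP h /eqP hs.
split=> // i j; rewrite !cast_ord_id; apply/esym.
by apply: (eq_allpairs_in h); rewrite mem_enum.
Qed.

Lemma isomorphic_refl (T : finType) (e e' : rel T) : e =2 e' -> isomorphic e e'.
Proof. by move=> h; exists id => [|u v]; [exists id | rewrite h]. Qed.

Lemma isomorphic_sym (T1 T2 : finType) (e1 : rel T1) (e2 : rel T2) :
  isomorphic e1 e2 -> isomorphic e2 e1.
Proof.
case=> f [g fg gf] h; exists g; first by exists f.
by move=> u v; rewrite -h !gf.
Qed.

Lemma isomorphic_trans (T1 T2 T3 : finType) (e1 : rel T1) (e2 : rel T2) (e3 : rel T3) :
  isomorphic e1 e2 -> isomorphic e2 e3 -> isomorphic e1 e3.
Proof.
case=> f bf hf [g bg hg]; exists (g \o f); first exact: bij_comp.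
by move=> u v /=; rewrite hg hf.
Qed.

Lemma encode_cat_isomorphic n m (e : rel 'I_n) (e' : rel 'I_m) s s' :
  encode e ++ s = encode e' ++ s' -> isomorphic e e' /\ s = s'.
Proof.
case/encode_cat_inj => en [h hs]; split=> //.
by exists (cast_ord en) => //; exists (cast_ord (esym en)) => i;
  rewrite ?cast_ordK ?cast_ordKV.
Qed.

(** The second encoding starts at [q]. *)
Definition parses (x : seq bool) n m :=
  let q := n.+1 + n * n in
  [/\ ~~ nth false x n, forall k, k < n -> nth false x k,
      ~~ nth false x (q + m), forall k, k < m -> nth false x (q + k) &
      size x = q + m.+1 + m * m].

Lemma parsesP x n m : parses x n m ->
  x = encode (matrix_at x n.+1 (n := n)) ++
      encode (matrix_at x (n.+1 + n * n + m.+1) (n := m)).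
Proof.
case=> h1 h2 h3 h4 h5.
rewrite !encode_matrix_at ?h5; [|lia|lia].
set q := n.+1 + n * n in h3 h4 h5 *.
have key p l : (forall k, k < l -> nth false x (p + k)) -> ~~ nth false x (p + l) ->
    p + l < size x -> drop p x = nseq l true ++ false :: drop (p + l.+1) x.
  elim: l p => [|l ih] p hk hl hs.
    rewrite addn0 addn1 in hl hs *; rewrite (drop_nth false) //.
    by rewrite (negPf hl).
  rewrite (drop_nth false); last by lia.
  have := hk 0 isT; rewrite addn0 => -> /=; congr cons; rewrite -addSnnS ih //.
  - by move=> k hk'; rewrite addSnnS; apply: hk.
  - by rewrite addSnnS.
  - by rewrite addSnnS.
have hd : drop (q + m.+1) x = take (m * m) (drop (q + m.+1) x).
  by rewrite take_oversize // size_drop h5; lia.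
rewrite -hd -(key q m) //; last by rewrite h5; lia.
rewrite -catA cat_cons.
have -> : take (n * n) (drop n.+1 x) ++ drop q x = drop n.+1 x.
  by rewrite /q addnC -drop_drop cat_take_drop.
have := @key 0 n h2 h1; rewrite drop0 add0n => <- //; rewrite h5; lia.
Qed.

Lemma parses_encode n m (e : rel 'I_n) (e' : rel 'I_m) :
  parses (encode e ++ encode e') n m.
Proof.
have sz := size_encode e.
have left k : k <= n -> nth false (encode e ++ encode e') k = (k < n).
  move=> hk; rewrite nth_cat ifT; last by rewrite sz; lia.
  exact: nth_encode.
have right k : k <= m ->
    nth false (encode e ++ encode e') (n.+1 + n * n + k) = (k < m).
  move=> hk; have -> : n.+1 + n * n + k = size (encode e) + k by rewrite sz; lia.
  by rewrite nth_cat ltnNge leq_addr /= addKn nth_encode.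
split=> [|k hk||k hk|].
- by rewrite left // ltnn.
- by rewrite left // ltnW.
- by rewrite right // ltnn.
- by rewrite right // ltnW.
- by rewrite size_cat !size_encode; lia.
Qed.

(** This is what makes the exhaustive search over pairs of sizes sound: at most one pair produces
    output. *)
Lemma parses_inj x n m n' m' : parses x n m -> parses x n' m' -> n = n' /\ m = m'.
Proof.
move=> /parsesP {1}-> /parsesP/encode_cat_inj[en [_]].
rewrite -[encode _]cats0 -[RHS]cats0 => /encode_cat_inj[em _].
by [].
Qed.

(** * Bounded quantifiers and bounded loops *)

Definition TEq a b := TAnd (TNot (TLt a b)) (TNot (TLt b a)).
Definition TExLt d n t := TEx (TAnd (TLt d n) t).
Definition TAllLt d n t := TNot (TExLt d n (TNot t)).
Definition GForLt d n g := GFor (GIf (TLt d n) g GNil).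

Section Evaluation.

Variable x : seq bool.

Lemma eval_TEq env a b :
  eval_test x env (TEq a b) = (nth 0 env a == nth 0 env b).
Proof. by rewrite /= -!leqNgt andbC -eqn_leq. Qed.

Lemma nth_rcons_lt env v a : a < size env -> nth 0 (rcons env v) a = nth 0 env a.
Proof. by move=> h; rewrite nth_rcons h. Qed.

(** [TEx] only reaches positions of the input. It covers all vertices of an encoded graph because
    these are fewer than the letters of the encoding, whence the condition [N <= size x]. *)
Lemma eval_TExLt env a t N : a < size env -> nth 0 env a = N -> N <= size x ->
  eval_test x env (TExLt (size env) a t) =
  [exists i : 'I_N, eval_test x (rcons env i) t].
Proof.
move=> ha hN hx; apply/hasP/existsP => /= [[v]|[i hi]].
  rewrite mem_iota => hv; rewrite nth_rcons_last nth_rcons_lt // hN.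
  by case/andP=> vN ht; exists (Ordinal vN).
exists (val i); first by rewrite mem_iota (leq_trans (ltn_ord i) hx).
by rewrite nth_rcons_last nth_rcons_lt // hN ltn_ord.
Qed.

Lemma eval_TAllLt env a t N : a < size env -> nth 0 env a = N -> N <= size x ->
  eval_test x env (TAllLt (size env) a t) =
  [forall i : 'I_N, eval_test x (rcons env i) t].
Proof.
move=> ha hN hx; rewrite -[LHS]/(~~ eval_test x env (TExLt (size env) a (TNot t))).
rewrite (eval_TExLt _ ha hN hx) negb_exists; apply: eq_forallb => i.
by rewrite /= negbK.
Qed.

Lemma eval_GForLt env a g N : a < size env -> nth 0 env a = N -> N <= size x ->
  eval x env (GForLt (size env) a g) =
  flatten [seq eval x (rcons env (val i)) g | i <- enum 'I_N].
Proof.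
move=> ha hN hx /=; rewrite -(subnKC hx) iotaD map_cat flatten_cat add0n.
rewrite [X in _ ++ X](_ : _ = [::]) ?cats0.
  rewrite -enum_ordE -map_comp; congr flatten; apply: eq_map => i /=.
  by rewrite nth_rcons_last nth_rcons_lt // hN ltn_ord.
rewrite (eq_in_map _ (fun=> [::]) _).1 => [|v].
  by elim: iota.
rewrite mem_iota => /andP[hv _]; rewrite nth_rcons_last nth_rcons_lt // hN.
by rewrite ltnNge hv.
Qed.

End Evaluation.

(** Level 0 holds 1; level [8] the number of vertices of [e] and level [9] the
    position of its adjacency matrix. *)
Definition locates x (env : seq nat) n (e : rel 'I_n) :=
  [/\ size env = 10, nth 0 env 0 = 1, nth 0 env 8 = n, n <= size x &
      forall i j : 'I_n, nth false x (nth 0 env 9 + (i * n + j)) = e i j].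

(** Levels: 0 the number 1; 1 and 3 the number [n] of vertices of the first
    graph; 2 and 4 the number [m] for the second one; 5 the length of the first
    encoding; 6 the position of the zero that ends the second unary number;
    7 the expected length of the input. *)
Definition guard : test :=
  TAnd (TNot (TBit 1)) (TAnd (TAllLt 8 1 (TBit 8))
  (TAnd (TNot (TBit 6)) (TAnd (TAllLt 8 2 (TLet 0 [:: (5, 0); (8, 0)] (TBit 9)))
    (TEx (TLet 1 [:: (8, 0)] (TAnd (TEq 9 7) (TNot (TEx (TLt 8 10))))))))).

(** The binder is a parameter so that the validity test and the generator run in the same
    environment. Since level 0 holds 1, a pair with second component 0 contributes just its first
    factor. *)
Definition on_first A (let_ : nat -> seq (nat * nat) -> A -> A) a :=
  let_ 0 [:: (1, 0)] (let_ 1 [:: (1, 0)] a).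
Definition on_second A (let_ : nat -> seq (nat * nat) -> A -> A) a :=
  let_ 0 [:: (2, 0)] (let_ 1 [:: (6, 0)] a).

(** The empty word encodes no pair of graphs, so [GNil] yields a no-instance. *)
Definition transform (phi : test) (body : gen) : gen :=
  GIf (TAnd guard (TAnd (on_first TLet phi) (on_second TLet phi)))
    (GCat (on_first GLet body) (on_second GLet body)) GNil.

(** Levels 3 and 4 duplicate levels 1 and 2 because a product needs two distinct registers, and the
    lengths of the matrices are the squares of [n] and [m]. *)
Definition parse_then (g : gen) : gen :=
  GLet 1 [::] (GFor (GFor (GLet 0 [:: (1, 0)] (GLet 0 [:: (2, 0)]
    (GLet 1 [:: (1, 0); (1, 3)] (GLet 0 [:: (5, 0); (2, 0)]
      (GLet 1 [:: (6, 0); (2, 4)] g))))))).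

Definition parse_env n m : seq nat :=
  let q := n.+1 + n * n in [:: 1; n; m; n; m; q; q + m; q + m.+1 + m * m].

Lemma eval_parse_then x g : eval x [::] (parse_then g) =
  flatten [seq flatten [seq eval x (parse_env n m) g | m <- iota 0 (size x)]
           | n <- iota 0 (size x)].
Proof.
rewrite /=; congr flatten; apply: eq_map => n; congr flatten; apply: eq_map => m.
congr (eval x _ g); rewrite /value /= /parse_env; congr [:: _; _; _; _; _; _; _; _].
all: lia.
Qed.

Lemma eval_guard x n m : n < size x -> m < size x ->
  reflect (parses x n m) (eval_test x (parse_env n m) guard).
Proof.
(* The language has no name for the length of the input: [tot] finds the last position, the one that
   no position exceeds, and compares its successor with the expected length. *)
move=> hn hm; rewrite /guard; set tot := TEx _.
have totE : eval_test x (parse_env n m) tot = (size x == n.+1 + n * n + m.+1 + m * m).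
  rewrite /tot; apply/hasP/eqP => [[l]|hs].
    rewrite mem_iota /= => hl /andP[h1 /hasPn h2].
    have {h1} h1 : l.+1 = n.+1 + n * n + m.+1 + m * m.
      apply/eqP; rewrite eqn_leq; move: h1; rewrite -!leqNgt /value /=; lia.
    apply/eqP; rewrite -h1 eqn_leq hl andbT leqNgt; apply/negP => hl'.
    have := h2 l.+1; rewrite mem_iota /= hl' => /(_ isT).
    by rewrite ltnS leqnn.
  exists (size x).-1; first by rewrite mem_iota; lia.
  rewrite /= /value /=; apply/andP; split; first by rewrite -!leqNgt; lia.
  by apply/hasPn => v; rewrite mem_iota; lia.
set env := parse_env n m.
have e1 := @eval_TAllLt x env 1 (TBit 8) n isT erefl (ltnW hn).
have e2 := @eval_TAllLt x env 2 (TLet 0 [:: (5, 0); (8, 0)] (TBit 9)) m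
  isT erefl (ltnW hm).
rewrite [size env]/= in e1 e2.
have {e1} e1 : eval_test x env (TAllLt 8 1 (TBit 8)) = [forall i : 'I_n, nth false x i].
  by rewrite e1; apply: eq_forallb.
have {e2} e2 : eval_test x env (TAllLt 8 2 (TLet 0 [:: (5, 0); (8, 0)] (TBit 9))) =
    [forall i : 'I_m, nth false x (n.+1 + n * n + i)].
  rewrite e2; apply: eq_forallb => i /=; rewrite /value /=; congr nth; lia.
have -> : eval_test x env guard = [&& ~~ nth false x n,
    [forall i : 'I_n, nth false x i], ~~ nth false x (n.+1 + n * n + m),
    [forall i : 'I_m, nth false x (n.+1 + n * n + i)] &
    size x == n.+1 + n * n + m.+1 + m * m].
  by rewrite -e1 -e2 -totE.
apply: (iffP and5P) => -[h1 h2 h3 h4 h5]; split=> //.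
- by move=> k hk; have /forallP/(_ (Ordinal hk)) := h2.
- by move=> k hk; have /forallP/(_ (Ordinal hk)) := h4.
- exact/eqP.
- by apply/forallP => i; apply: h2.
- by apply/forallP => i; apply: h4.
- exact/eqP.
Qed.

Lemma flatten_single (T : eqType) (S : Type) (F : T -> seq S) s k :
  uniq s -> k \in s -> (forall l, l \in s -> l != k -> F l = [::]) ->
  flatten [seq F l | l <- s] = F k.
Proof.
elim: s => //= l s ih /andP[ls us]; rewrite inE; have [->|nk] := eqVneq k l; last first.
  move=> /= ks h; rewrite h ?inE ?eqxx 1?eq_sym // ih // => l' hl'.
  by apply: h; rewrite inE hl' orbT.
move=> _ h; rewrite [X in _ ++ X](_ : _ = [::]) ?cats0 //.
rewrite (eq_in_map _ (fun=> [::]) _).1 => [|l' hl']; first by elim: (s).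
by apply: h; rewrite ?inE ?hl' ?orbT //; apply: contraNneq ls => <-.
Qed.

(** * Reductions from a validity test and a graph transformation *)

Section Reduction.

Variables (P Q : forall T : finType, rel T -> Prop) (phi : test) (body : gen).
Variables (N : nat -> nat) (J : forall n, rel 'I_n -> rel 'I_(N n)).
Arguments P [T].
Arguments Q [T].

Hypothesis phiP : forall x env n (e : rel 'I_n), locates x env e ->
  reflect (P e) (eval_test x env phi).
Hypothesis bodyE : forall x env n (e : rel 'I_n), locates x env e ->
  eval x env body = encode (J e).

Let second n m := n.+1 + n * n + m.+1.

Lemma locates_first x n m : n <= size x ->
  locates x (rcons (rcons (parse_env n m) n) n.+1) (matrix_at x n.+1 (n := n)).
Proof. by move=> h; split. Qed.

Lemma locates_second x n m : m <= size x ->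
  locates x (rcons (rcons (parse_env n m) m) (second n m))
    (matrix_at x (second n m) (n := m)).
Proof. by move=> h; split. Qed.

Lemma eval_on_first x n m :
  (eval_test x (parse_env n m) (on_first TLet phi) =
   eval_test x (rcons (rcons (parse_env n m) n) n.+1) phi) *
  (eval x (parse_env n m) (on_first GLet body) =
   eval x (rcons (rcons (parse_env n m) n) n.+1) body).
Proof.
split; rewrite /on_first /= /value /=;
  [congr (eval_test x _ phi) | congr (eval x _ body)]; rewrite /parse_env /=;
  congr [:: _; _; _; _; _; _; _; _; _; _]; lia.
Qed.

Lemma eval_on_second x n m :
  (eval_test x (parse_env n m) (on_second TLet phi) =
   eval_test x (rcons (rcons (parse_env n m) m) (second n m)) phi) *
  (eval x (parse_env n m) (on_second GLet body) =
   eval x (rcons (rcons (parse_env n m) m) (second n m)) body).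
Proof.
split; rewrite /on_second /= /value /=;
  [congr (eval_test x _ phi) | congr (eval x _ body)]; rewrite /parse_env /second /=;
  congr [:: _; _; _; _; _; _; _; _; _; _]; lia.
Qed.

Lemma eval_transform x n m : n < size x -> m < size x ->
  let G := matrix_at x n.+1 (n := n) in
  let H := matrix_at x (second n m) (n := m) in
  (parses x n m /\ P G /\ P H /\
    eval x (parse_env n m) (transform phi body) = encode (J G) ++ encode (J H)) \/
  (~ (parses x n m /\ P G /\ P H) /\
    eval x (parse_env n m) (transform phi body) = [::]).
Proof.
move=> hn hm G H.
rewrite -[eval _ _ _]/(if [&& eval_test x (parse_env n m) guard,
    eval_test x (parse_env n m) (on_first TLet phi) &
    eval_test x (parse_env n m) (on_second TLet phi)]
  then eval x (parse_env n m) (on_first GLet body) ++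
       eval x (parse_env n m) (on_second GLet body) else [::]).
rewrite !eval_on_first !eval_on_second.
have lG := locates_first m (ltnW hn); have lH := locates_second n (ltnW hm).
case: (eval_guard hn hm) => hg; last by right; split=> // -[].
case: (phiP lG) => pG; last by right; split=> // -[_ []].
case: (phiP lH) => pH; last by right; split=> // -[_ []].
by left; rewrite (bodyE lG) (bodyE lH).
Qed.

Hypothesis PQ : forall n (e : rel 'I_n), P e -> Q (J e).
Hypothesis J_iso : forall n m (e : rel 'I_n) (e' : rel 'I_m), P e -> P e' ->
  isomorphic e e' <-> isomorphic (J e) (J e').
Hypothesis P_ext : forall n (e e' : rel 'I_n), e =2 e' -> P e -> P e'.

Let prog := parse_then (transform phi body).

(** By [parses_inj] every other pair of sizes contributes the empty word, so only one summand of the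
    double concatenation survives. *)
Lemma eval_prog x n m :
  let G := matrix_at x n.+1 (n := n) in
  let H := matrix_at x (second n m) (n := m) in
  parses x n m -> P G -> P H ->
  eval x [::] prog = encode (J G) ++ encode (J H).
Proof.
move=> G H px pG pH; have sx := px; case: sx => _ _ _ _ sx.
have hn : n < size x by rewrite sx; lia.
have hm : m < size x by rewrite sx; lia.
have empty n' m' : n' < size x -> m' < size x -> (n' != n) || (m' != m) ->
    eval x (parse_env n' m') (transform phi body) = [::].
  move=> hn' hm' ne; case: (eval_transform hn' hm') => [[px' _]|[]//].
  by have [? ?] := parses_inj px px'; subst n' m'; rewrite !eqxx in ne.
rewrite eval_parse_then (@flatten_single _ _ _ _ n) ?iota_uniq ?mem_iota //.
  rewrite (@flatten_single _ _ _ _ m) ?iota_uniq ?mem_iota //.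
    by case: (eval_transform hn hm) => [[_ [_ []]]//|[[]]].
  by move=> m'; rewrite mem_iota => /= hm' nm; apply: empty => //; rewrite nm orbT.
move=> n'; rewrite mem_iota => /= hn' nn.
rewrite (eq_in_map _ (fun=> [::]) _).1 => [|m']; first by elim: iota.
by rewrite mem_iota => /= hm'; apply: empty => //; rewrite nn.
Qed.

Lemma eval_prog_nonempty x : eval x [::] prog <> [::] ->
  exists n m, let G := matrix_at x n.+1 (n := n) in
    let H := matrix_at x (second n m) (n := m) in
    [/\ parses x n m, P G & P H].
Proof.
rewrite eval_parse_then; set s := flatten _.
case es : s => [//|b s'] _; have : b \in s by rewrite es mem_head.
case/flattenP => r /mapP[n]; rewrite mem_iota add0n leq0n => hn ->.
case/flattenP => r' /mapP[m]; rewrite mem_iota add0n leq0n => hm -> hb; exists n, m.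
case: (eval_transform hn hm) => [[px [pG [pH _]]] //|[_ e]].
by rewrite e in hb.
Qed.

Lemma eval_prog_reduces x :
  iso_problem P x <-> iso_problem Q (eval x [::] prog).
Proof.
split=> [[n [m [e [e' [pe pe' ex iso]]]]]|].
  have px : parses x n m by rewrite ex; apply: parses_encode.
  (* The program sees the matrices read off [x]; they agree with [e] and [e'] entry by entry, and
     [P_ext] transfers validity to them. *)
  have := parsesP px; rewrite {1}ex => /encode_cat_inj[en1 [h1 h2]].
  have := h2; rewrite -[LHS]cats0 -[RHS]cats0 => /encode_cat_inj[en2 [h3 _]].
  have i1 : e =2 matrix_at x n.+1 (n := n) by move=> i j; rewrite -h1 !cast_ord_id.
  have i2 : e' =2 matrix_at x (second n m) (n := m).
    by move=> i j; rewrite -h3 !cast_ord_id.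
  have p1 := P_ext i1 pe; have p2 := P_ext i2 pe'.
  exists (N n), (N m), (J (matrix_at x n.+1 (n := n))),
    (J (matrix_at x (second n m) (n := m))).
  split; [exact: PQ | exact: PQ | exact: eval_prog |].
  apply/(J_iso p1 p2).
  apply: isomorphic_trans (isomorphic_trans iso (isomorphic_refl i2)).
  exact/isomorphic_sym/isomorphic_refl.
move=> [k [l [K [L [qK qL eKL KL]]]]].
(* An encoding of a pair has at least one letter, and any output at all certifies that the input was
   valid. *)
have : eval x [::] prog <> [::].
  rewrite eKL => /(congr1 size).
  by rewrite size_cat size_encode addnS.
case/eval_prog_nonempty => n [m] [px pG pH].
exists n, m, (matrix_at x n.+1 (n := n)), (matrix_at x (second n m) (n := m)).
split=> //; first exact: parsesP.
have := eval_prog px pG pH; rewrite eKL => /encode_cat_isomorphic[iK].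
rewrite -[LHS]cats0 -[RHS]cats0 => /encode_cat_isomorphic[iL _].
apply/(J_iso pG pH).
exact: isomorphic_trans (isomorphic_sym iK) (isomorphic_trans KL iL).
Qed.

(** Ten levels are bound when [phi] and [body] start; the innermost quantifier of [guard] binds
    level 10, hence [10 < D]. *)
Theorem reduction D : 10 < D -> wf_test D 10 phi -> wf D 10 body ->
  poly_reducible (iso_problem P) (iso_problem Q).
Proof.
move=> hD wphi wbody; exists (fun x => eval x [::] prog); last exact: eval_prog_reduces.
apply: (@eval_polytime D).
rewrite /prog /parse_then /transform /= /on_first /on_second /wf_sum /= wphi wbody.
by do ![apply/andP; split=> //]; lia.
Qed.

End Reduction.

Lemma map_enum_val (T : finType) : [seq enum_val i | i <- enum 'I_#|T|] = enum T.
Proof.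
case: (pickP (pred_of_simpl (@predT T))) => [x0 _|h].
  rewrite (eq_map (enum_val_nth x0)) (map_comp (nth x0 (enum T)) val).
  by rewrite enum_ordE cardE; apply: mkseq_nth.
have T0 : #|T| = 0 by apply: eq_card0.
have -> : enum T = [::] by apply: size0nil; rewrite -cardE.
by apply: size0nil; rewrite size_map size_enum_ord.
Qed.

(** * Interpretations of graphs in graphs *)

Section Interpretation.

Variables (a b : nat) (ent : nat -> nat -> bool -> bool -> bool -> bool).

Definition vertex n : finType := ('I_a * 'I_n + 'I_b)%type.

Definition code n (v : vertex n) : nat :=
  match v with inl (k, _) => k | inr s => a + s end.

(** There are [a] layers, each a copy of the vertex set, and [b] extra vertices whose codes follow
    those of the layers. An entry depends only on the two codes and on the arcs and the equality
    between the underlying vertices, so isomorphisms of graphs lift to the interpretations. *)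
Definition interp n (e : rel 'I_n) : rel (vertex n) := fun s t =>
  match s, t with
  | inl (k, u), inl (l, v) => ent k l (e u v) (e v u) (u == v)
  | _, _ => ent (code s) (code t) false false false
  end.

Definition interp_ord n (e : rel 'I_n) : rel 'I_#|vertex n| :=
  fun i j => interp e (enum_val i) (enum_val j).

Lemma interp_ord_iso n (e : rel 'I_n) : isomorphic (interp_ord e) (interp e).
Proof. by exists enum_val => //; apply: enum_val_bij. Qed.

(** The canonical enumeration goes layer by layer and ends with the extra vertices, which is the
    order in which [each] generates rows and columns. *)
Lemma enum_vertex n : enum (vertex n) =
  [seq inl (k, u) | k <- enum 'I_a, u <- enum 'I_n] ++ [seq inr s | s <- enum 'I_b].
Proof.
rewrite enumT /vertex unlock /= /sum_enum -!enumT; congr cat.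
have -> : enum {: 'I_a * 'I_n} = [seq (k, u) | k <- enum 'I_a, u <- enum 'I_n].
  by rewrite enumT unlock.
by rewrite map_allpairs.
Qed.

Definition each d (f : 'I_a -> gen) (f' : 'I_b -> gen) : gen :=
  GCat (foldr GCat GNil [seq GForLt d 8 (f k) | k <- enum 'I_a])
       (foldr GCat GNil [seq f' s | s <- enum 'I_b]).

Lemma eval_GCats (I : Type) x env (f : I -> gen) s :
  eval x env (foldr GCat GNil [seq f k | k <- s]) =
  flatten [seq eval x env (f k) | k <- s].
Proof. by elim: s => //= k s ->. Qed.

Lemma eval_each x env n f f' (F : vertex n -> seq bool) :
  8 < size env -> nth 0 env 8 = n -> n <= size x ->
  (forall k (u : 'I_n), eval x (rcons env u) (f k) = F (inl (k, u))) ->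
  (forall s, eval x env (f' s) = F (inr s)) ->
  eval x env (each (size env) f f') = flatten [seq F v | v <- enum (vertex n)].
Proof.
move=> h8 hn hx hf hf'; rewrite /each [LHS]/= !eval_GCats.
rewrite enum_vertex map_cat flatten_cat -(map_comp F inr); congr cat.
  rewrite map_allpairs; elim: (enum 'I_a) => //= k s ih.
  rewrite flatten_cat; congr cat; last exact: ih.
  rewrite -[LHS]/(eval x env (GForLt (size env) 8 (f k))).
  rewrite (eval_GForLt _ h8 hn hx); congr flatten; apply: eq_map => u.
  exact: hf.
by congr flatten; apply: eq_map => s; apply: hf'.
Qed.

Definition adjacency d u v := TLet 0 [:: (9, 0); (u, 8); (v, 0)] (TBit d).

(** [ent] is a function outside the language, so the program branches over all eight values of its
    Boolean arguments and emits a constant in each case. *)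
Definition cell (k l : nat) : gen :=
  let out p q r := GEmit (ent k l p q r) in
  let by_eq p q := GIf (TEq 10 11) (out p q true) (out p q false) in
  let by_rev p := GIf (adjacency 12 11 10) (by_eq p true) (by_eq p false) in
  GIf (adjacency 12 10 11) (by_rev true) (by_rev false).

Definition plain k l := GEmit (ent k l false false false).

Definition interp_gen : gen :=
  GCat (each 10 (fun=> GEmit true) (fun=> GEmit true))
  (GCat (GEmit false)
    (each 10 (fun k => each 11 (fun l => cell k l) (fun s => plain k (a + s)))
             (fun s => each 10 (fun l => plain (a + s) l)
                               (fun t => plain (a + s) (a + t))))).

Lemma eval_adjacency x env env' n (e : rel 'I_n) p q (i j : 'I_n) :
  locates x env e -> (forall r, r < 10 -> nth 0 env' r = nth 0 env r) ->
  p < size env' -> q < size env' -> 10 <= size env' ->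
  nth 0 env' p = i -> nth 0 env' q = j ->
  eval_test x env' (adjacency (size env') p q) = e i j.
Proof.
case=> sz h0 h8 _ he agree lp lq l10 hp hq.
rewrite -he /= nth_rcons_last /value /= hp hq !agree // h0 h8.
congr nth; lia.
Qed.

Lemma eval_cell x env n (e : rel 'I_n) (u v : 'I_n) k l : locates x env e ->
  eval x (rcons (rcons env u) v) (cell k l) = [:: ent k l (e u v) (e v u) (u == v)].
Proof.
move=> loc; have [sz _ _ _ _] := loc.
have adj (i j : 'I_n) p q : p < 12 -> q < 12 ->
    nth 0 (rcons (rcons env u) v) p = i -> nth 0 (rcons (rcons env u) v) q = j ->
    eval_test x (rcons (rcons env u) v) (adjacency 12 p q) = e i j.
  have sz2 : size (rcons (rcons env u) v) = 12 by rewrite !size_rcons sz.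
  move=> hp hq hpi hqj; rewrite -[in adjacency _ _ _]sz2.
  apply: (eval_adjacency loc); rewrite ?sz2 // => r hr.
  by rewrite !nth_rcons_lt ?size_rcons ?sz // (leq_trans hr).
have hu : nth 0 (rcons (rcons env u) v) 10 = u by rewrite !nth_rcons !size_rcons sz.
have hv : nth 0 (rcons (rcons env u) v) 11 = v by rewrite !nth_rcons !size_rcons sz.
have auv := adj u v 10 11 isT isT hu hv; have avu := adj v u 11 10 isT isT hv hu.
have euv : eval_test x (rcons (rcons env u) v) (TEq 10 11) = (u == v).
  by rewrite eval_TEq hu hv.
rewrite /cell; cbn [eval]; rewrite auv avu euv.
by case: (e u v); case: (e v u); case: (u == v).
Qed.

Lemma eval_interp_gen x env n (e : rel 'I_n) : locates x env e ->
  eval x env interp_gen = encode (interp_ord e).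
Proof.
move=> loc; have [sz h0 h8 hx he] := loc.
have s8 : 8 < size env by rewrite sz.
have bits_row (F : vertex n -> bool) s : flatten [seq [:: F v] | v <- s] = map F s.
  by elim: s => //= v s ->.
have e10 f f' F := @eval_each x env n f f' F s8 h8 hx; rewrite sz in e10.
rewrite -[LHS]/(eval x env (each 10 _ _) ++ false :: eval x env (each 10 _ _)).
rewrite (e10 _ _ (fun=> [:: true])) // bits_row.
rewrite (e10 _ _ (fun s => [seq interp e s t | t <- enum (vertex n)])).
- rewrite /encode; congr cat; last congr cons.
    by rewrite cardE; elim: (enum _) => //= v s ->.
  rewrite -[LHS]/[seq interp e s t | s <- enum (vertex n), t <- enum (vertex n)].
  by rewrite -map_enum_val allpairs_mapl allpairs_mapr.
- move=> k u.
  have e11 f f' F := @eval_each x (rcons env u) n f f' F.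
  rewrite size_rcons sz nth_rcons_lt // in e11.
  rewrite -bits_row; apply: e11 => // l v.
  exact: eval_cell.
- by move=> s; rewrite -bits_row; apply: e10.
Qed.

End Interpretation.

(** * Reductions by interpretations *)

Section InterpretationReduction.

Variables (a b : nat) (ent : nat -> nat -> bool -> bool -> bool -> bool).
Local Notation interp := (@interp a b ent).

Lemma wf_each D d f f' : 8 < d < D ->
  (forall k, wf D d.+1 (f k)) -> (forall s, wf D d (f' s)) -> wf D d (@each a b d f f').
Proof.
case/andP=> hd dD hf hf'.
have cats (T : Type) (g : T -> gen) s : (forall k, wf D d (g k)) ->
    wf D d (foldr GCat GNil [seq g k | k <- s]).
  by move=> h; elim: s => //= k s ->; rewrite h.
rewrite /= !cats // => k; rewrite /= hf dD !andbT.
by rewrite ltnSn (leq_trans hd (leqnSn d)) /= neq_ltn hd orbT.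
Qed.

(** Fourteen registers are shared by the generator and the validity tests; the deepest level in use,
    13, is bound by [adjacency] inside [path_test]. *)
Lemma wf_interp_gen : wf 14 10 (interp_gen a b ent).
Proof.
apply/andP; split; first exact: wf_each.
by apply/andP; split=> //; apply: wf_each => // k; apply: wf_each.
Qed.

Lemma interp_iso n m (e : rel 'I_n) (e' : rel 'I_m) :
  isomorphic e e' -> isomorphic (interp e) (interp e').
Proof.
case=> f [g fg gf] h.
exists (fun v => match v with inl (k, u) => inl (k, f u) | inr s => inr s end).
  exists (fun v => match v with inl (k, u) => inl (k, g u) | inr s => inr s end).
    by move=> [[k u]|s]; rewrite ?fg.
  by move=> [[k u]|s]; rewrite ?gf.
move=> [[k u]|s] [[l v]|t] //=; rewrite !h; congr ent.
by rewrite (can_eq fg).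
Qed.

Variables (P Q : forall T : finType, rel T -> Prop) (phi : test).
Arguments P [T].
Arguments Q [T].

Definition iso_invariant (R : forall T : finType, rel T -> Prop) :=
  forall (T T' : finType) (e : rel T) (e' : rel T'),
    isomorphic e e' -> R T e -> R T' e'.

Hypothesis P_invariant : iso_invariant P.
Hypothesis Q_invariant : iso_invariant Q.
Hypothesis phiP : forall x env n (e : rel 'I_n), locates x env e ->
  reflect (P e) (eval_test x env phi).
Hypothesis wf_phi : wf_test 14 10 phi.
Hypothesis P_interp : forall n (e : rel 'I_n), P e -> Q (interp e).
Hypothesis interp_reflects : forall n m (e : rel 'I_n) (e' : rel 'I_m),
  P e -> P e' -> isomorphic (interp e) (interp e') -> isomorphic e e'.

Theorem interp_reduction : poly_reducible (iso_problem P) (iso_problem Q).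
Proof.
apply: (reduction phiP (@eval_interp_gen a b ent) _ _ _ _ wf_phi wf_interp_gen) => //.
- move=> n e pe; apply: Q_invariant (P_interp pe).
  exact/isomorphic_sym/interp_ord_iso.
- move=> n m e e' pe pe'; have i1 := @interp_ord_iso a b ent; split=> h.
    apply: isomorphic_trans (i1 _ e) _; apply: isomorphic_trans (interp_iso h) _.
    exact/isomorphic_sym/i1.
  apply: interp_reflects => //.
  apply: isomorphic_trans (isomorphic_sym (i1 _ e)) _.
  exact: isomorphic_trans h (i1 _ e').
- by move=> n e e' h; apply: P_invariant; apply: isomorphic_refl.
Qed.

End InterpretationReduction.

(** * Validity of the input graphs: invariance and tests *)

Lemma simple_graph_invariant : iso_invariant simple_graph.
Proof.
move=> T T' e e' /isomorphic_sym[f _ h] [sym irr]; split=> [u v|u].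
  by rewrite -!h.
by rewrite -h.
Qed.

Lemma oriented_clique_invariant : iso_invariant oriented_clique.
Proof.
move=> T T' e e' iso [[irr anti] path].
have [f [g fg gf] h] := isomorphic_sym iso.
have path' u v : directed_2path e (f u) (f v) -> directed_2path e' u v.
  by case=> w; rewrite -[w]gf !h; exists (g w).
split; first by split=> [u|u v]; rewrite -!h.
move=> u v uv; rewrite -!h => /path[|/path'|/path']; [|by left|by right].
by rewrite (can_eq fg).
Qed.

Lemma locates_all x env n (e : rel 'I_n) t : locates x env e ->
  eval_test x env (TAllLt 10 8 (TAllLt 11 8 t)) =
  [forall u : 'I_n, forall v : 'I_n, eval_test x (rcons (rcons env u) v) t].
Proof.
case=> sz _ h8 hx _; rewrite -sz (@eval_TAllLt _ _ _ _ n) ?sz //.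
apply: eq_forallb => u.
have su : size (rcons env u) = 11 by rewrite size_rcons sz.
by rewrite -[in TAllLt 11 _ _]su (@eval_TAllLt _ _ _ _ n) ?su ?nth_rcons_lt ?sz.
Qed.

Lemma locates_adjacency x env n (e : rel 'I_n) (u v : 'I_n) l :
  locates x env e -> let env' := env ++ [:: val u, val v & l] in
  forall p q (i j : 'I_n), p < size env' -> q < size env' ->
  nth 0 env' p = i -> nth 0 env' q = j ->
  eval_test x env' (adjacency (size env') p q) = e i j.
Proof.
move=> loc env' p q i j hp hq hpi hqj; have [sz _ _ _ _] := loc.
by apply: (eval_adjacency loc) => // [r hr|]; rewrite ?nth_cat ?size_cat ?sz ?hr.
Qed.

Definition simple_test : test :=
  TAllLt 10 8 (TAllLt 11 8
    (TAnd (TNot (adjacency 12 10 10))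
          (TNot (TAnd (adjacency 12 10 11) (TNot (adjacency 12 11 10)))))).

Definition path_test p q : test :=
  TExLt 12 8 (TAnd (adjacency 13 p 12) (adjacency 13 12 q)).

Definition clique_test : test :=
  TAllLt 10 8 (TAllLt 11 8
    (TAnd (TNot (adjacency 12 10 10))
    (TAnd (TNot (TAnd (adjacency 12 10 11) (adjacency 12 11 10)))
      (TNot (TAnd (TNot (TEq 10 11))
            (TAnd (TNot (adjacency 12 10 11))
            (TAnd (TNot (adjacency 12 11 10))
            (TAnd (TNot (path_test 10 11)) (TNot (path_test 11 10)))))))))).

Section Tests.

Variables (x : seq bool) (env : seq nat) (n : nat) (e : rel 'I_n).
Hypothesis loc : locates x env e.

Let sz : size env = 10. Proof. by case: loc. Qed.

Lemma eval_adjacency2 (u v : 'I_n) :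
  let env' := rcons (rcons env u) v in
  [/\ eval_test x env' (adjacency 12 10 10) = e u u,
      eval_test x env' (adjacency 12 10 11) = e u v &
      eval_test x env' (adjacency 12 11 10) = e v u].
Proof.
have := @locates_adjacency x env n e u v [::] loc; rewrite /= size_cat sz [10 + _]/=.
rewrite -cat1s catA !cats1 => h; split; apply: h => //;
  by rewrite !nth_rcons ?size_rcons sz.
Qed.

Lemma eval_path_test (u v : 'I_n) :
  let env' := rcons (rcons env u) v in
  (eval_test x env' (path_test 10 11) = [exists w, e u w && e w v]) *
  (eval_test x env' (path_test 11 10) = [exists w, e v w && e w u]).
Proof.
have [_ _ h8 hx _] := loc.
have adj (w : 'I_n) := @locates_adjacency x env n e u v [:: val w] loc.
move=> env'; have sz' : size env' = 12 by rewrite !size_rcons sz.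
have adj' (w : 'I_n) p q (i j : 'I_n) : p < 13 -> q < 13 ->
    nth 0 (rcons env' w) p = i -> nth 0 (rcons env' w) q = j ->
    eval_test x (rcons env' w) (adjacency 13 p q) = e i j.
  have -> : rcons env' w = env ++ [:: val u; val v; val w].
    by rewrite /env' -!cats1 -!catA.
  move: (adj w p q i j); rewrite size_cat sz; exact.
have n10 w : nth 0 (rcons env' w) 10 = u by rewrite !nth_rcons ?size_rcons sz.
have n11 w : nth 0 (rcons env' w) 11 = v by rewrite !nth_rcons ?size_rcons sz.
have n12 w : nth 0 (rcons env' w) 12 = w by rewrite !nth_rcons ?size_rcons sz.
have path p q : eval_test x env' (path_test p q) = [exists w : 'I_n,
    eval_test x (rcons env' w) (adjacency 13 p 12) &&
    eval_test x (rcons env' w) (adjacency 13 12 q)].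
  rewrite /path_test -sz'; apply: eval_TExLt => //; first by rewrite sz'.
  by rewrite !nth_rcons ?size_rcons sz.
by split; rewrite path; apply: eq_existsb => w; congr andb; apply: adj'.
Qed.

Lemma simple_testP : reflect (simple_graph e) (eval_test x env simple_test).
Proof.
rewrite (locates_all _ loc); set t := TAnd _ _.
have tE (u v : 'I_n) : eval_test x (rcons (rcons env u) v) t =
    ~~ e u u && ~~ (e u v && ~~ e v u).
  by have [e1 e2 e3] := eval_adjacency2 u v; rewrite -e1 -e2 -e3.
apply: (iffP forallP) => [h|[sym irr] u].
  have {}h u v : ~~ e u u /\ (e u v -> e v u).
    have /forallP/(_ v) := h u; rewrite tE.
    by rewrite negb_and negbK => /andP[-> /orP[/negPf->|->]].
  split=> [u v|u]; last by have [/negPf] := h u u.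
  by apply/idP/idP; apply: (h _ _).2.
by apply/forallP => v; rewrite tE irr (sym v u) andbN.
Qed.

Lemma clique_testP : reflect (oriented_clique e) (eval_test x env clique_test).
Proof.
rewrite (locates_all _ loc).
set t := TAnd _ _.
have tE (u v : 'I_n) : eval_test x (rcons (rcons env u) v) t =
  [&& ~~ e u u, ~~ (e u v && e v u) & ~~ [&& u != v, ~~ e u v, ~~ e v u,
    ~~ [exists w, e u w && e w v] & ~~ [exists w, e v w && e w u]]].
  have [e1 e2 e3] := eval_adjacency2 u v; have [e4 e5] := eval_path_test u v.
  rewrite -e1 -e2 -e3 -e4 -e5 /t.
  have -> : (u != v) = ~~ eval_test x (rcons (rcons env u) v) (TEq 10 11).
    by rewrite eval_TEq !nth_rcons ?size_rcons sz.
  by [].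
apply: (iffP forallP) => [h|[[irr anti] path] u].
  have {}h u v : [/\ ~~ e u u, ~~ (e u v && e v u) & ~~ [&& u != v, ~~ e u v, ~~ e v u,
    ~~ [exists w, e u w && e w v] & ~~ [exists w, e v w && e w u]]].
    by apply/and3P; rewrite -tE; have /forallP := h u.
  split; first split=> [u|u v]; first by have [/negPf] := h u u.
    by have [] := h u v.
  move=> u v uv; rewrite negb_or => /andP[nuv nvu].
  have [_ _] := h u v; rewrite uv nuv nvu /= -negb_or negbK.
  by case/orP=> /existsP; [left | right].
apply/forallP => v; rewrite tE irr anti /=; apply/and5P => -[uv nuv nvu p1 p2].
have [|[w hw]|[w hw]] := path u v uv; first by rewrite negb_or nuv.
  by case/existsP: p1; exists w.
by case/existsP: p2; exists w.
Qed.

End Tests.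

(** * The two reductions *)

Lemma ord3P (P : 'I_3 -> Prop) :
  P (@Ordinal 3 0 isT) -> P (@Ordinal 3 1 isT) -> P (@Ordinal 3 2 isT) ->
  forall k, P k.
Proof.
by move=> h0 h1 h2 [[|[|[|k]]] hk] //; rewrite (bool_irrelevance hk isT).
Qed.

Lemma isomorphic_interp_card a b ent n m (e : rel 'I_n) (e' : rel 'I_m) : 0 < a ->
  isomorphic (@interp a b ent n e) (@interp a b ent m e') -> n = m.
Proof.
move=> ha [f /bij_eq_card]; rewrite !card_sum !card_prod !card_ord => h _.
by apply/eqP; rewrite -(eqn_pmul2l ha) -(eqn_add2r b) h.
Qed.

(** The [fi] are the maps that an isomorphism of interpretations induces on the layers. Taking
    [u = v] in the links to layer 2 shows that all three coincide, and the same links give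
    injectivity. *)
Lemma isomorphic_of_copies n m (e : rel 'I_n) (e' : rel 'I_m) (f0 f1 f2 : 'I_n -> 'I_m) :
  n = m -> (forall u v, (f0 u == f2 v) = (u == v)) ->
  (forall u v, (f1 u == f2 v) = (u == v)) ->
  (forall u v, e' (f0 u) (f1 v) = e u v) -> isomorphic e e'.
Proof.
move=> nm h02 h12 h01.
have e02 : f0 =1 f2 by move=> u; apply/eqP; rewrite h02.
have e12 : f1 =1 f2 by move=> u; apply/eqP; rewrite h12.
exists f0; last by move=> u v; rewrite -h01 e12 !e02.
apply: inj_card_bij; last by rewrite !card_ord nm.
by move=> u v /eqP; rewrite [f0 v]e02 h02 => /eqP.
Qed.

(** Layers 0, 1, 2 hold a copy of every vertex: [e] is read off the arcs from
    layer 0 to layer 1, and layer 2 links the copies of a vertex. Two vertices of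
    one layer are joined by a directed 2-path through another layer. The extra
    vertices 3 and 4 are adjacent to all others, and their arcs tell the layers
    apart. *)
Definition to_clique (s t : nat) (uv vu eq : bool) : bool :=
  match s, t with
  | 0, 1 => uv
  | 1, 0 => ~~ vu
  | 0, 2 | 1, 2 => eq
  | 2, 0 | 2, 1 => ~~ eq
  | 3, 0 | 3, 1 | 3, 4 | 2, 3 | 4, 0 | 1, 4 | 2, 4 => true
  | _, _ => false
  end.

Local Notation clique_of := (@interp 3 2 to_clique _).
Local Notation l0 := (@Ordinal 3 0 isT).
Local Notation l1 := (@Ordinal 3 1 isT).
Local Notation l2 := (@Ordinal 3 2 isT).
Local Notation t0 := (@Ordinal 2 0 isT).
Local Notation t1 := (@Ordinal 2 1 isT).

Lemma clique_of_oriented_clique n (e : rel 'I_n) :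
  simple_graph e -> oriented_clique (clique_of e).
Proof.
case=> sym irr; split; first split.
- by move=> [[[[|[|[|k]]] hk] u]|[[|[|s]] hs]].
- move=> [[[[|[|[|k]]] hk] u]|[[|[|s]] hs]] [[[[|[|[|l]]] hl] v]|[[|[|t]] ht]] //=;
    rewrite ?[v == u]eq_sym ?andbN ?andNb //.
- move=> [[k u]|s] [[l v]|t].
  (* Any two vertices of different layers are joined by an arc, so a non-adjacent pair lies within
     one layer. *)
  + move=> huv hadj; have kl : k = l.
      apply/eqP; move: hadj; apply: contraR.
      move: k l {huv}; apply: ord3P; apply: ord3P => //= _;
        rewrite ?[v == u]eq_sym ?(sym v u) ?orbN ?orNb //.
    have uv : u != v by move: huv; rewrite kl; apply: contraNneq => ->.
    (* Arcs into layer 2 join copies of the same vertex and arcs out of it, to layers 0 and 1,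
       copies of different vertices; one arc of each sort leads from [u] to [v] within a layer. *)
    left; move: k kl {huv hadj} => k <-; move: k; apply: ord3P.
    * by exists (inl (l2, u)) => /=; rewrite eqxx uv.
    * by exists (inl (l2, u)) => /=; rewrite eqxx uv.
    * by exists (inl (l0, v)) => /=; rewrite eqxx uv.
  + by move: k t => [[|[|[|k]]] hk] [[|[|t]] ht].
  + by move: l s => [[|[|[|k]]] hk] [[|[|t]] ht].
  + by move: s t => [[|[|s]] hs] [[|[|t]] ht].
Qed.

(** * Recovering the layers of the oriented clique *)

Definition dominating (T : finType) (e : rel T) (s : T) :=
  forall t, t != s -> e s t || e t s.

Lemma dominating_iso (T T' : finType) (e : rel T) (e' : rel T') f s :
  bijective f -> (forall u v, e' (f u) (f v) = e u v) ->
  dominating e s -> dominating e' (f s).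
Proof.
case=> g fg gf h ds t ts; rewrite -[t]gf !h; apply: ds.
by apply: contraNneq ts => <-; rewrite gf.
Qed.

(** Vertices of one layer are pairwise non-adjacent, so as soon as layers have two elements only the
    extra vertices can dominate. *)
Lemma dominating_clique_of n (e : rel 'I_n) (v : vertex 3 2 n) : 1 < n ->
  dominating (clique_of e) v <-> exists s, v = inr s.
Proof.
move=> hn; split=> [|[s ->]].
  case: v => [[k u] dom|s]; last by exists s.
  have [w wu] : exists w : 'I_n, w != u.
    have h0 : 0 < n by apply: ltn_trans hn.
    have [->|u0] := eqVneq u (Ordinal h0); first by exists (Ordinal hn).
    by exists (Ordinal h0); rewrite eq_sym.
  have : inl (k, w) != inl (k, u) :> vertex 3 2 n.
    by apply: contraNneq wu => -[->].
  by move/dom; move: k {dom}; apply: ord3P.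
move=> [[l w]|t].
  by move=> _; move: l s => [[|[|[|k]]] hk] [[|[|t]] ht].
by move: s t => [[|[|s]] hs] [[|[|t]] ht].
Qed.

Lemma clique_of_reflects n m (e : rel 'I_n) (e' : rel 'I_m) :
  simple_graph e -> simple_graph e' ->
  isomorphic (clique_of e) (clique_of e') -> isomorphic e e'.
Proof.
move=> [sym irr] [sym' irr'] iso.
have nm := isomorphic_interp_card (isT : 0 < 3) iso.
(* In a layer with a single element that element dominates too, so this case is separate; but then
   both graphs have no edges. *)
have [n1|n1] := leqP n 1.
  subst m; apply: isomorphic_refl => u v.
  have -> : u = v by apply: val_inj; case: u v => [u hu] [v hv] /=; lia.
  by rewrite irr irr'.
have m1 : 1 < m by rewrite -nm.
have [f bf h] := iso; have [g fg gf] := bf.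
have fr s : exists s', f (inr s) = inr s'.
  apply/(dominating_clique_of e' _ m1)/(dominating_iso bf h).
  by apply/(dominating_clique_of e _ n1); exists s.
(* The arc from the first extra vertex to the second one fixes both. *)
have [ft0 ft1] : f (inr t0) = inr t0 /\ f (inr t1) = inr t1.
  have [s0 e0] := fr t0; have [s1 e1] := fr t1.
  have := h (inr t0) (inr t1); rewrite e0 e1 /=.
  by move: s0 s1 {e0 e1} => [[|[|s]] hs] [[|[|t]] ht] //= _;
    split; congr inr; apply: val_inj.
(* Layer 0 receives arcs from both extra vertices, layer 1 from the first only, layer 2 from
   neither. *)
have fl k u : exists u', f (inl (k, u)) = inl (k, u').
  case e1 : (f (inl (k, u))) => [[k' u']|s].
    exists u'; congr (inl (_, _)).
    have := h (inr t0) (inl (k, u)); have := h (inr t1) (inl (k, u)).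
    rewrite ft0 ft1 e1 /=.
    by move: k k' {e1}; apply: ord3P; apply: ord3P.
  (* A layer vertex cannot be sent to an extra vertex, which is already its own image. *)
  have [s' es] : exists s', inl (k, u) = inr s' :> vertex 3 2 n; last by [].
  exists s; apply: (can_inj fg); rewrite e1.
  move: s {e1} => [[|[|s]] hs] //.
    by rewrite (_ : Ordinal hs = t0) ?ft0 //; apply: val_inj.
  by rewrite (_ : Ordinal hs = t1) ?ft1 //; apply: val_inj.
have [f0 h0] := fin_all_exists (fl l0).
have [f1 h1] := fin_all_exists (fl l1).
have [f2 h2] := fin_all_exists (fl l2).
apply: (@isomorphic_of_copies _ _ e e' f0 f1 f2 nm) => u v.
- by have := h (inl (l0, u)) (inl (l2, v)); rewrite h0 h2.
- by have := h (inl (l1, u)) (inl (l2, v)); rewrite h1 h2.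
- by have := h (inl (l0, u)) (inl (l1, v)); rewrite h0 h1.
Qed.

(** [e] is read off the edges between layers 0 and 1, whose copies of a vertex
    have a common neighbour in layer 2. Layers 3, 4, 5 are pendant: one leaf marks
    layer 0, two leaves mark layer 1. *)
Definition to_simple (s t : nat) (uv vu eq : bool) : bool :=
  match s, t with
  | 0, 1 => uv
  | 1, 0 => vu
  | 0, 2 | 2, 0 | 1, 2 | 2, 1 | 0, 3 | 3, 0 | 1, 4 | 4, 1 | 1, 5 | 5, 1 => eq
  | _, _ => false
  end.

Local Notation simple_of := (@interp 6 0 to_simple _).
Local Notation layer i := (@Ordinal 6 i isT).

Lemma simple_of_simple_graph n (e : rel 'I_n) : simple_graph (simple_of e).
Proof.
split.
  move=> [[[k hk] u]|[]//] [[[l hl] v]|[]//] /=; rewrite [v == u]eq_sym.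
  by move: k l {hk hl} => [|[|[|[|[|[|k]]]]]] [|[|[|[|[|[|l]]]]]].
by move=> [[[[|[|[|[|[|[|k]]]]]] hk] u]|[]].
Qed.

(** * Recovering the layers of the simple graph *)

Definition leaf (T : finType) (e : rel T) (v : T) :=
  forall w w', e v w -> e v w' -> w = w'.
Definition has_leaf (T : finType) (e : rel T) (v : T) :=
  exists2 w, e v w & leaf e w.
Definition has_two_leaves (T : finType) (e : rel T) (v : T) :=
  exists w w', [/\ w <> w', e v w, e v w', leaf e w & leaf e w'].

Section LeafInvariance.

Variables (T T' : finType) (e : rel T) (e' : rel T') (f : T -> T').
Hypothesis (bf : bijective f) (h : forall u v, e' (f u) (f v) = e u v).

Lemma leaf_iso v : leaf e v -> leaf e' (f v).
Proof.
have [g fg gf] := bf; move=> lv w w'.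
by rewrite -[w]gf -[w']gf !h => /lv h1 /h1 ->.
Qed.

Lemma has_leaf_iso v : has_leaf e v -> has_leaf e' (f v).
Proof. by case=> w vw /leaf_iso lw; exists (f w); rewrite ?h. Qed.

Lemma has_two_leaves_iso v : has_two_leaves e v -> has_two_leaves e' (f v).
Proof.
case=> w [w' [ww vw vw' lw lw']]; exists (f w), (f w').
by split; rewrite ?h //; [move/(bij_inj bf) | apply: leaf_iso | apply: leaf_iso].
Qed.

End LeafInvariance.

Section SimpleOf.

Variables (n : nat) (e : rel 'I_n).

(** Whatever [e] is, a vertex of layer 0 or 1 has its copy in layer 2 and a pendant vertex as
    neighbours, and a vertex of layer 2 has two copies; so even isolated vertices of [e] create no
    leaf in these layers. *)
Lemma leaf_simple_of k u : leaf (simple_of e) (inl (k, u)) <-> 3 <= k.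
Proof.
split.
  have contra w w' : w <> w' -> simple_of e (inl (k, u)) w ->
    simple_of e (inl (k, u)) w' -> leaf (simple_of e) (inl (k, u)) -> 3 <= k.
    by move=> ww h h' /(_ _ _ h h').
  move: k contra => [[|[|[|k]]] hk] contra //.
  - by apply: (contra (inl (layer 2, u)) (inl (layer 3, u))); rewrite //= eqxx.
  - by apply: (contra (inl (layer 2, u)) (inl (layer 4, u))); rewrite //= eqxx.
  - by apply: (contra (inl (layer 0, u)) (inl (layer 1, u))); rewrite //= eqxx.
move: k => [[|[|[|[|[|[|k]]]]]] hk] // _;
  move=> [[[[|[|[|[|[|[|l]]]]]] hl] v]|[]//] //
    [[[[|[|[|[|[|[|l']]]]]] hl'] v']|[]//] //= /eqP <- /eqP <-;
  by congr (inl (_, _)); apply: val_inj.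
Qed.

Lemma has_leaf_simple_of k u : has_leaf (simple_of e) (inl (k, u)) <-> k <= 1.
Proof.
split.
  case=> -[[l v]|[]//] + /leaf_simple_of.
  by move: k l => [[|[|[|[|[|[|k]]]]]] hk] [[|[|[|[|[|[|l]]]]]] hl].
move: k => [[|[|k]] hk] // _.
  by exists (inl (layer 3, u)); rewrite /= ?eqxx //; apply/leaf_simple_of.
by exists (inl (layer 4, u)); rewrite /= ?eqxx //; apply/leaf_simple_of.
Qed.

Lemma has_two_leaves_simple_of k u :
  has_two_leaves (simple_of e) (inl (k, u)) <-> k = 1 :> nat.
Proof.
split.
  case=> -[[l v]|[]//] [[[l' v']|[]//]] [ww + + /leaf_simple_of + /leaf_simple_of].
  move: k l l' ww => [[|[|[|[|[|[|k]]]]]] hk] [[|[|[|[|[|[|l]]]]]] hl] //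
    [[|[|[|[|[|[|l']]]]]] hl'] //= ww /eqP uv /eqP uv'; case: ww.
  by rewrite -uv -uv'; congr (inl (_, _)); apply: val_inj.
move: k => [[|[|k]] hk] // _.
exists (inl (layer 4, u)), (inl (layer 5, u)); split; rewrite //= ?eqxx //;
  exact/leaf_simple_of.
Qed.

End SimpleOf.

Lemma simple_of_reflects n m (e : rel 'I_n) (e' : rel 'I_m) :
  isomorphic (simple_of e) (simple_of e') -> isomorphic e e'.
Proof.
move=> iso; have nm := isomorphic_interp_card (isT : 0 < 6) iso.
have [f bf h] := iso; have [g fg gf] := bf.
have bg : bijective g by exists f.
have h' u v : simple_of e (g u) (g v) = simple_of e' u v by rewrite -h !gf.
have fl (k : 'I_6) u : k <= 2 -> exists u', f (inl (k, u)) = inl (k, u').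
  move=> k2; case ef : (f (inl (k, u))) => [[k' u']|[]//].
  exists u'; congr (inl (_, _)); apply: val_inj.
  have eg : g (inl (k', u')) = inl (k, u) by rewrite -ef fg.
  (* Being a leaf, having a leaf and having two leaves together separate layers 0, 1 and 2 from one
     another and from the pendant layers. *)
  have a1 : 3 <= k' -> 3 <= k.
    by move=> /(leaf_simple_of e' k' u')/(leaf_iso bg h'); rewrite eg => /leaf_simple_of.
  have a2 : k' <= 1 <-> k <= 1.
    split=> [/(has_leaf_simple_of e' k' u')/(has_leaf_iso bg h')|
             /(has_leaf_simple_of e k u)/(has_leaf_iso bf h)].
      by rewrite eg => /has_leaf_simple_of.
    by rewrite ef => /has_leaf_simple_of.
  have a3 : k' = 1 :> nat <-> k = 1 :> nat.
    split=> [/(has_two_leaves_simple_of e' k' u')/(has_two_leaves_iso bg h')|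
             /(has_two_leaves_simple_of e k u)/(has_two_leaves_iso bf h)].
      by rewrite eg => /has_two_leaves_simple_of.
    by rewrite ef => /has_two_leaves_simple_of.
  rewrite /=; move: (nat_of_ord k) (nat_of_ord k') k2 a1 a2 a3 => i j; lia.
have [f0 h0] := fin_all_exists (fun u => fl (layer 0) u isT).
have [f1 h1] := fin_all_exists (fun u => fl (layer 1) u isT).
have [f2 h2] := fin_all_exists (fun u => fl (layer 2) u isT).
apply: (@isomorphic_of_copies _ _ e e' f0 f1 f2 nm) => u v.
- by have := h (inl (layer 0, u)) (inl (layer 2, v)); rewrite h0 h2.
- by have := h (inl (layer 1, u)) (inl (layer 2, v)); rewrite h1 h2.
- by have := h (inl (layer 0, u)) (inl (layer 1, v)); rewrite h0 h1.
Qed.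

Theorem theorem13 : GI_complete OCLIQUEISO.
Proof.
split.
  apply: (@interp_reduction 6 0 to_simple _ _ clique_test).
  - exact: oriented_clique_invariant.
  - exact: simple_graph_invariant.
  - exact: clique_testP.
  - by [].
  - by move=> n e _; apply: simple_of_simple_graph.
  - by move=> n m e e' _ _; apply: simple_of_reflects.
apply: (@interp_reduction 3 2 to_clique _ _ simple_test).
- exact: simple_graph_invariant.
- exact: oriented_clique_invariant.
- exact: simple_testP.
- by [].
- exact: clique_of_oriented_clique.
- exact: clique_of_reflects.
Qed.
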